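(* Let $n\le N$ be positive integers. Then for every $\pi\in\mathcal{I}(n)$, $$\Upsilon_{\iota(\pi);(GL_N,O_N)}=\Upsilon_{\pi;(GL_n,O_n)},$$ and for every $\pi\in\mathcal{I}_{\mathrm{fpf}}(2n)$, $$\Upsilon_{\iota_{\mathrm{fpf}}(\pi);(GL_{2N},Sp_{2N})}=\Upsilon_{\pi;(GL_{2n},Sp_{2n})}$$ (equalities of polynomials).
   Context: Divided differences: $\partial_i(f)=\dfrac{f-s_i(f)}{x_i-x_{i+1}}$, where $s_i$ acts on polynomials by swapping $x_i$ and $x_{i+1}$. Also $s_i=(i,i+1)$ denotes the simple transposition in a symmetric group, $\ell$ is Coxeter length, and $w_0$ is the longest element of the symmetric group in question ($w_0(i)=m+1-i$ in $S_m$). Case $(GL_n,O_n)$: $\mathcal{I}(n)=\{\pi\in S_n:\pi^2=\mathrm{id}\}$. For $\pi\in\mathcal{I}(n)$ and $1\le i\le n-1$ define $s_i\cdot\pi$ by: (a) if $\ell(s_i\pi)>\ell(\pi)$, then $s_i\cdot\pi=\pi$; (b) otherwise, if $s_i\pi s_i\ne\pi$, then $s_i\cdot\pi=s_i\pi s_i$, and the edge from $\pi$ to $s_i\cdot\pi$ labelled $i$ is called solid; (c) otherwise $s_i\cdot\pi=s_i\pi$, and the edge from $\pi$ to $s_i\cdot\pi$ labelled $i$ is called dashed. The weak order on $\mathcal{I}(n)$ is generated by the relations $\pi\prec s_i\cdot\pi$ whenever $s_i\cdot\pi\neq\pi$; every $\pi\in\mathcal{I}(n)$ is reachable from the minimum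 $w_0$. Case $(GL_{2n},Sp_{2n})$: $\mathcal{I}_{\mathrm{fpf}}(2n)$ is the set of fixed-point-free involutions in $S_{2n}$. For $\pi\in\mathcal{I}_{\mathrm{fpf}}(2n)$ and $1\le i\le 2n-1$: (a') if $\ell(s_i\pi)>\ell(\pi)$ or $s_i\pi s_i=\pi$, then $s_i\cdot\pi=\pi$; (b') otherwise $s_i\cdot\pi=s_i\pi s_i$ (all edges are solid). The weak order is generated by $\pi\prec s_i\cdot\pi$ whenever $s_i\cdot\pi\ne\pi$; every element is reachable from the minimum $w_0$. A labelled path from $w_0$ to $\pi$ is an expression $\pi=s_{i_1}\cdot(s_{i_2}\cdot\,\cdots\,(s_{i_l}\cdot w_0)\cdots)$ in which each successive application of an $s_{i_k}$ changes the element. $\Upsilon$-polynomials: $\Upsilon_{w_0;(GL_n,O_n)}=\prod_{1\le i\le j\le n-i}(x_i+x_j)$ and $\Upsilon_{w_0;(GL_{2n},Sp_{2n})}=\prod_{1\le i<j\le 2n-i}(x_i+x_j)$. For a labelled path $\pi=s_{i_1}\cdot(\cdots(s_{i_l}\cdot w_0)\cdots)$ one defines $\Upsilon_{\pi}:=\widetilde\partial_{i_1}\widetilde\partial_{i_2}\cdots\widetilde\partial_{i_l}\Upsilon_{w_0}$ for the respective pair, where $\widetilde\partial_{i}=\partial_{i}$ if the corresponding edge of the path is solid and $\widetilde\partial_{i}=\tfrac12\partial_{i}$ if it is dashed. The result is independent of the chosen labelled path (an established fact of the paper), so $\Upsilon_\pi$ is well defined for each pair. Embeddings: $\iota:S_n\hookrightarrow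 S_N$ sends $\pi$ to the permutation $\pi'$ with $\pi'(i)=\pi(i)$ for $i\le n$ and $\pi'(i)=i$ for $i>n$; it maps $\mathcal{I}(n)$ into $\mathcal{I}(N)$. The map $\iota_{\mathrm{fpf}}:S_{2n}\hookrightarrow S_{2N}$ sends $\pi$ to the permutation $\pi'$ which coincides with $\pi$ on $\{1,\ldots,2n\}$ and which transposes $i$ and $i+1$ for $i=2n+1,2n+3,\ldots,2N-1$; it maps $\mathcal{I}_{\mathrm{fpf}}(2n)$ into $\mathcal{I}_{\mathrm{fpf}}(2N)$. *)

(* Defs.v *)
From HB Require Import structures.
From mathcomp Require Import all_boot all_fingroup all_algebra.
From mathcomp Require Import mpoly zify.

Set Implicit Arguments.
Unset Strict Implicit.
Unset Printing Implicit Defensive.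

Import GRing.Theory.
Local Open Scope ring_scope.

(* Indices are 0-based: 'I_n stands for {1,...,n}, and the label i in
   {1,...,n-1} is an element of 'I_n.-1.  Permutations act on the right in
   MathComp, (s * t)%g x = t (s x), so the product "s_i pi" of the mathematics
   (apply pi first) is (pi * simple i)%g. *)

Section SimpleTranspositions.
Variable n : nat.
Implicit Types (i : 'I_n.-1) (s w : 'S_n).

Lemma ord_next_subproof i : (i.+1 < n)%N.
Proof. by rewrite -ltn_predRL. Qed.

Definition ord_this i : 'I_n := widen_ord (leq_pred n) i.
Definition ord_next i : 'I_n := Ordinal (ord_next_subproof i).

Definition simple i : 'S_n := tperm (ord_this i) (ord_next i).

Lemma simple_val i (a : 'I_n) :
  simple i a = (if a == i :> nat then i.+1
                else if a == i.+1 :> nat then i : nat else a) :> nat.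
Proof.
rewrite /simple; case: tpermP => [->|->|/eqP a1 /eqP a2] /=.
- by rewrite eqxx.
- by rewrite eqxx gtn_eqF.
- by move: a1 a2; rewrite -!val_eqE /= => /negbTE -> /negbTE ->.
Qed.

Lemma simpleV i : (simple i)^-1%g = simple i. Proof. exact: tpermV. Qed.
Lemma simpleK i : (simple i * simple i = 1)%g. Proof. exact: tperm2. Qed.

Definition inversions w : {set 'I_n * 'I_n} :=
  [set p : 'I_n * 'I_n | (p.1 < p.2)%N && (w p.2 < w p.1)%N].

Lemma inversions_ascent i w : (w (ord_this i) < w (ord_next i))%N ->
  #|inversions (simple i * w)%g| = #|inversions w|.+1.
Proof.
move=> asc; pose f (p : 'I_n * 'I_n) := (simple i p.1, simple i p.2).
have fK : involutive f by move=> [a b]; rewrite /f /= !tpermK.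
have -> : inversions (simple i * w)%g
    = (ord_this i, ord_next i) |: f @: inversions w.
  apply/setP => -[a b]; rewrite in_setU1 -{3}[(a, b)]fK mem_imset; last first.
    exact: inv_inj.
  rewrite !inE /= !permM; case: eqVneq => [[-> ->]|neq] /=.
    by rewrite ltnS leqnn /= /simple tpermL tpermR asc.
  case: (eqVneq (a, b) (ord_next i, ord_this i)) => [[-> ->]|neq'] /=.
    rewrite /simple tpermL tpermR !ltnNge (ltnW asc) andbF.
    by rewrite andbF.
  congr andb; move: neq neq' (simple_val i a) (simple_val i b).
  rewrite !xpair_eqE -!val_eqE /=.
  move: (simple i a) (simple i b) => sa sb; clear asc f fK w.
  by do 4?case: eqVneq => ? /=; lia.
rewrite cardsU1 card_imset; last exact: inv_inj.
rewrite -{1}[(_, _)]fK mem_imset; last exact: inv_inj.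
rewrite inE /= /simple tpermL tpermR /= ltnNge ltnW //.
Qed.

Lemma inversions_descent i w : (w (ord_next i) < w (ord_this i))%N ->
  #|inversions w| = #|inversions (simple i * w)%g|.+1.
Proof.
move=> desc; rewrite -(@inversions_ascent i (simple i * w)%g).
  by rewrite mulgA simpleK mul1g.
by rewrite !permM /simple tpermL tpermR.
Qed.

Lemma ascent_or_descent i w : (w (ord_this i) < w (ord_next i))%N
  \/ (w (ord_next i) < w (ord_this i))%N.
Proof.
case: ltngtP => [||/val_inj/perm_inj/(congr1 val)/=]; [by left|by right|].
by move/n_Sn.
Qed.

Lemma inversions1 : #|inversions 1%g| = 0%N.
Proof.
by apply: eq_card0 => -[a b]; rewrite !inE /= !perm1; case: (ltngtP a b).
Qed.

Lemma inversionsV w : #|inversions w^-1%g| = #|inversions w|.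
Proof.
pose f (p : 'I_n * 'I_n) := (w^-1%g p.2, w^-1%g p.1).
have f_inj : injective f by move=> [a b] [c d] [/perm_inj -> /perm_inj ->].
rewrite -(card_imset _ f_inj); apply: eq_card => -[a b].
have -> : (a, b) = f (w b, w a) by rewrite /f /= !permK.
by rewrite mem_imset // !inE /f /= !permK andbC.
Qed.

Lemma monotone_perm1 w :
  (forall i, w (ord_this i) < w (ord_next i))%N -> w = 1%g.
Proof.
move=> mono.
have lb k : forall a : 'I_n, a = k :> nat -> (k <= w a)%N.
  elim: k => // k IH a ak.
  have kn : (k < n.-1)%N by have := ltn_ord a; lia.
  have /IH : ord_this (Ordinal kn) = k :> nat by [].
  move=> le; apply: leq_ltn_trans le (leq_trans (mono _) _).
  by rewrite (_ : ord_next _ = a) //; apply: val_inj.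
have ub k : forall a : 'I_n, (a + k).+1 = n -> (w a + k < n)%N.
  elim: k => [|k IH] a ak; first by rewrite addn0.
  have an : (a < n.-1)%N by lia.
  have := mono (Ordinal an); have := IH (ord_next (Ordinal an)).
  rewrite (_ : ord_this _ = a) /=; last exact: val_inj.
  move=> /(_ ltac:(lia)); lia.
apply/permP => a; rewrite perm1; apply: val_inj => /=.
have := lb _ a erefl; have := ub (n - a.+1)%N a; have := ltn_ord a; lia.
Qed.

Definition word_prod (t : seq 'I_n.-1) : 'S_n := (\prod_(i <- t) simple i)%g.

Lemma word_of_perm w :
  [exists t : #|inversions w|.-tuple 'I_n.-1, word_prod t == w].
Proof.
move: {2}#|_| (erefl #|inversions w|) => k; elim: k w => [|k IH] w wk.
  rewrite wk; apply/existsP; exists [tuple]; rewrite /word_prod big_nil eq_sym.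
  apply/eqP/monotone_perm1 => i.
  by case: (ascent_or_descent i w) => // /inversions_descent; rewrite wk.
have [i desc] : exists i, (w (ord_next i) < w (ord_this i))%N.
  apply/existsP; apply: contraT => /existsPn no.
  suff w1 : w = 1%g by rewrite w1 inversions1 in wk.
  by apply: monotone_perm1 => i; case: (ascent_or_descent i w) (no i) => // ->.
have siw := inversions_descent desc; rewrite siw.
have /IH/existsP[t /eqP tw] : #|inversions (simple i * w)%g| = k.
  by apply/succn_inj; rewrite -siw.
apply/existsP; exists [tuple of i :: t].
by rewrite /word_prod big_cons [X in (_ * X)%g]tw mulgA simpleK mul1g.
Qed.

Lemma inversions_word t : (#|inversions (word_prod t)| <= size t)%N.
Proof.
rewrite /word_prod; elim: t => [|i t IH]; first by rewrite big_nil inversions1.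
rewrite big_cons; set w := (\prod_(_ <- _) _)%g in IH *.
case: (ascent_or_descent i w) => [/inversions_ascent -> //|].
by move/inversions_descent => e; rewrite /= leqW // ltnW // -e.
Qed.

Lemma word_exists w :
  exists k, [exists t : k.-tuple 'I_n.-1, word_prod t == w].
Proof. by eexists; apply: word_of_perm. Qed.

Definition coxeter_length w : nat := ex_minn (word_exists w).

Lemma coxeter_lengthE w : coxeter_length w = #|inversions w|.
Proof.
rewrite /coxeter_length; case: ex_minnP => k /existsP[t /eqP tw] kmin.
apply/eqP; rewrite eqn_leq kmin ?word_of_perm //=.
by rewrite -tw -[leqRHS](size_tuple t) inversions_word.
Qed.

Lemma coxeter_lengthV w : coxeter_length w^-1%g = coxeter_length w.
Proof. by rewrite !coxeter_lengthE inversionsV. Qed.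

Definition longest : 'S_n := perm (@rev_ord_inj n).

Lemma not_longest_ascent w : w != longest ->
  exists i, (w (ord_this i) < w (ord_next i))%N.
Proof.
move=> wl; apply/existsP; apply: contraT => /existsPn desc.
case/eqP: wl; have: (w * longest)%g = 1%g.
  apply: monotone_perm1 => i; rewrite !permM !permE /=.
  case: (ascent_or_descent i w) (desc i) => [-> //|dsc _].
  have := ltn_ord (w (ord_this i)); lia.
move/(canRL (mulgK _)) => ->; rewrite mul1g.
apply/permP => a; apply: (@perm_inj _ longest); rewrite permKV.
by rewrite !permE rev_ordK.
Qed.

Definition raises i w : bool :=
  (coxeter_length w < coxeter_length (w * simple i)%g)%N.

Definition conj_simple i w : 'S_n := (simple i * w * simple i)%g.

End SimpleTranspositions.

(* Labelled paths starting at w_0, for an arbitrary family of operations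
   [act i].  The word [:: i_1; ...; i_l] encodes
   s_{i_1} . (s_{i_2} . ... (s_{i_l} . w_0)). *)
Section LabelledPaths.
Variables (n : nat) (act : 'I_n.-1 -> 'S_n -> 'S_n).
Implicit Types (t : seq 'I_n.-1) (w : 'S_n).

Definition path_end t : 'S_n := foldr act (longest n) t.

Fixpoint all_steps_change t : bool :=
  if t is i :: t' then (act i (path_end t') != path_end t') && all_steps_change t'
  else true.

Definition labelled_path w t : bool := all_steps_change t && (path_end t == w).

End LabelledPaths.

Section Actions.
Variable n : nat.
Implicit Types (i : 'I_n.-1) (w : 'S_n).

Definition act_O i w : 'S_n :=
  if raises i w then w
  else if conj_simple i w != w then conj_simple i w
  else (w * simple i)%g.

(* An edge of a labelled path is solid when it is not dashed. *)
Definition dashed_O i w : bool := ~~ raises i w && (conj_simple i w == w).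

Definition act_Sp i w : 'S_n :=
  if raises i w || (conj_simple i w == w) then w else conj_simple i w.

End Actions.

Definition invol n : {set 'S_n} := [set w : 'S_n | (w * w == 1)%g].

Definition invol_fpf n : {set 'S_n} :=
  [set w in invol n | [forall a, w a != a]].

Section Reachability.
Variable n : nat.
Implicit Types (i : 'I_n.-1) (w : 'S_n).

Lemma involP w : reflect (w * w = 1)%g (w \in invol n).
Proof. by rewrite inE; apply: eqP. Qed.

Lemma involV w : w \in invol n -> w^-1%g = w.
Proof. by move/involP => ww; rewrite -[RHS](mulKg w) ww mulg1. Qed.

Lemma conj_invol i w : w \in invol n -> conj_simple i w \in invol n.
Proof.
move/involP => ww; apply/involP; rewrite /conj_simple.
rewrite !mulgA -(mulgA (simple i * w)%g (simple i)) simpleK mulg1.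
by rewrite -(mulgA (simple i) w) ww mulg1 simpleK.
Qed.

Lemma conj_fpf i w : w \in invol_fpf n -> conj_simple i w \in invol_fpf n.
Proof.
rewrite inE => /andP[wI /forallP fpf].
rewrite inE conj_invol //=; apply/forallP => a; rewrite !permM.
by rewrite (canF_eq (tpermK _ _)) fpf.
Qed.

Lemma ascent_length i w : w \in invol n -> (w (ord_this i) < w (ord_next i))%N ->
  coxeter_length (simple i * w)%g = (coxeter_length w).+1
  /\ coxeter_length (w * simple i)%g = (coxeter_length w).+1.
Proof.
move=> wI asc; have l1 : coxeter_length (simple i * w)%g = (coxeter_length w).+1.
  by rewrite !coxeter_lengthE inversions_ascent.
by split=> //; rewrite -coxeter_lengthV invMg simpleV involV.
Qed.

Lemma ascent_conj i w : w \in invol n -> (w (ord_this i) < w (ord_next i))%N ->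
  conj_simple i w != w ->
  coxeter_length (conj_simple i w) = (coxeter_length w).+2
  /\ ~~ raises i (conj_simple i w).
Proof.
move=> wI asc nc; have [l1 l2] := ascent_length wI asc.
have l3 : coxeter_length (conj_simple i w) = (coxeter_length w).+2.
  rewrite -l2 /conj_simple -mulgA !coxeter_lengthE inversions_ascent // !permM.
  set x := w _ in asc *; set y := w _ in asc *.
  have: (x, y) != (ord_this i, ord_next i).
    apply: contraNneq nc => -[xE yE]; apply/eqP/permP => a; rewrite !permM.
    rewrite /simple.
    case: (tpermP (ord_this i) (ord_next i) a) => [->|->|/eqP a1 /eqP a2].
    - by rewrite -/y yE -/x xE tpermR.
    - by rewrite -/x xE -/y yE tpermL.
    rewrite tpermD //.
    + by rewrite -xE (inj_eq perm_inj) eq_sym.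
    + by rewrite -yE (inj_eq perm_inj) eq_sym.
  rewrite xpair_eqE -!val_eqE /=; move: (simple_val i x) (simple_val i y) asc.
  move: (simple i x) (simple i y) => sx sy; move: x y => x y; clear.
  by do 4?case: eqVneq => ? /=; lia.
split=> //; rewrite /raises l3 /conj_simple -(mulgA (simple i * w)%g) simpleK.
by rewrite mulg1 l1 -leqNgt leqnSn.
Qed.

Lemma reachable_O_step w : w \in invol n -> w != longest n ->
  exists i, exists2 w', w' \in invol n &
    act_O i w' = w /\ (coxeter_length w < coxeter_length w')%N.
Proof.
move=> wI /not_longest_ascent[i asc]; exists i.
have [l1 l2] := ascent_length wI asc.
case: (eqVneq (conj_simple i w) w) => [c|nc].
  have sw : (simple i * w = w * simple i)%g.
    by rewrite -{2}c /conj_simple -mulgA simpleK mulg1.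
  exists (w * simple i)%g.
    apply/involP; rewrite -{1}sw mulgA -(mulgA _ w w) (involP _ wI).
    by rewrite mulg1 simpleK.
  rewrite l2 /act_O /raises /conj_simple -!mulgA simpleK !mulg1 l2.
  by rewrite ltnNge leqnSn /= sw eqxx.
exists (conj_simple i w); first exact: conj_invol.
have [l3 r] := ascent_conj wI asc nc; rewrite l3 /act_O (negbTE r).
have -> : conj_simple i (conj_simple i w) = w.
  by rewrite /conj_simple !mulgA simpleK mul1g -mulgA simpleK mulg1.
by rewrite eq_sym nc leqnSn.
Qed.

Lemma reachable_Sp_step w : w \in invol_fpf n -> w != longest n ->
  exists i, exists2 w', w' \in invol_fpf n &
    act_Sp i w' = w /\ (coxeter_length w < coxeter_length w')%N.
Proof.
move=> wF /not_longest_ascent[i asc]; exists i.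
have := wF; rewrite inE => /andP[wI /forallP fpf].
have nc : conj_simple i w != w.
  apply/eqP => /permP /(_ (ord_this i)); rewrite !permM /simple tpermL.
  case: tpermP => [e|e|_ _ /perm_inj/(congr1 val)/= /esym/n_Sn //] /esym e'.
    by move: asc; rewrite e e' /= ltnNge leqnSn.
  by have := fpf (ord_this i); rewrite e' eqxx.
exists (conj_simple i w); first exact: conj_fpf.
have [l3 r] := ascent_conj wI asc nc; rewrite l3 /act_Sp (negbTE r) /=.
have -> : conj_simple i (conj_simple i w) = w.
  by rewrite /conj_simple !mulgA simpleK mul1g -mulgA simpleK mulg1.
by rewrite eq_sym (negbTE nc) leqnSn.
Qed.

Lemma coxeter_length_bound w : (coxeter_length w <= n * n)%N.
Proof.
rewrite coxeter_lengthE (leq_trans (max_card _)) //.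
by rewrite card_prod card_ord.
Qed.

Lemma reachable_from_steps (act : 'I_n.-1 -> 'S_n -> 'S_n) (A : {set 'S_n}) :
  (forall w, w \in A -> w != longest n -> exists i, exists2 w', w' \in A &
     act i w' = w /\ (coxeter_length w < coxeter_length w')%N) ->
  forall w, w \in A -> exists t, labelled_path act w t.
Proof.
move=> step w; move: {2}(_ - _)%N (leqnn (n * n - coxeter_length w)) => k.
elim: k w => [|k IH] w wk wA;
  (case: (eqVneq w (longest n)) => [->|wl]; first by exists [::]; apply/andP);
  have [i [w' wA' [aw lt]]] := step w wA wl; have := coxeter_length_bound w'.
- by move: wk lt; clear; lia.
move=> bd; have /IH/(_ wA')[t /andP[ct /eqP et]] :
  (n * n - coxeter_length w' <= k)%N by move: wk lt bd; clear; lia.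
exists (i :: t); rewrite /labelled_path /= et aw ct eqxx !andbT.
by apply: contraTneq lt => ->; rewrite ltnn.
Qed.

Lemma labelled_path_O_exists w :
  w \in invol n -> exists t, labelled_path (@act_O n) w t.
Proof. by apply: reachable_from_steps; apply: reachable_O_step. Qed.

Lemma labelled_path_Sp_exists w :
  w \in invol_fpf n -> exists t, labelled_path (@act_Sp n) w t.
Proof. by apply: reachable_from_steps; apply: reachable_Sp_step. Qed.

End Reachability.

Section DividedDifferences.
Variable n : nat.
Implicit Types (i : 'I_n.-1) (f g : {mpoly rat[n]}).

Definition x_this i : {mpoly rat[n]} := 'X_(ord_this i).
Definition x_next i : {mpoly rat[n]} := 'X_(ord_next i).

Lemma divided_difference_exists i f :
  exists g, g * (x_this i - x_next i) == f - msym (simple i) f.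
Proof.
set d := _ - _; pose P f := exists g, g * d == f - msym (simple i) f.
have PM f1 f2 : P f1 -> P f2 -> P (f1 * f2).
  move=> [g1 /eqP e1] [g2 /eqP e2].
  exists (f1 * g2 + g1 * msym (simple i) f2); apply/eqP.
  rewrite mulrDl -mulrA e2 mulrAC e1 msymM mulrBr mulrBl.
  by rewrite addrA subrK.
have PX j : P 'X_j.
  rewrite /P msymX; case: (eqVneq j (ord_this i)) => [->|j1].
    exists 1; rewrite mul1r /d; apply/eqP; congr (_ - 'X_[_]).
    apply/mnmP => k; rewrite !mnmE simpleV /simple.
    by rewrite [_ == tperm _ _ _]eq_sym (canF_eq (tpermK _ _)) tpermL eq_sym.
  case: (eqVneq j (ord_next i)) => [->|j2].
    exists (-1); rewrite mulN1r opprB /d; apply/eqP; congr (_ - 'X_[_]).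
    apply/mnmP => k; rewrite !mnmE simpleV /simple.
    by rewrite [_ == tperm _ _ _]eq_sym (canF_eq (tpermK _ _)) tpermR eq_sym.
  exists 0; rewrite mul0r eq_sym subr_eq0; apply/eqP; congr 'X_[_].
  apply/mnmP => k; rewrite !mnmE simpleV /simple.
  rewrite [_ == tperm _ _ _]eq_sym (canF_eq (tpermK _ _)).
  by rewrite tpermD 1?eq_sym.
have P1 : P 1 by exists 0; rewrite mul0r msym1 subrr.
rewrite -/(P f) [f]mpolyE; elim/big_rec: _ => [|m f' _ [g' /eqP e']].
  by exists 0; rewrite mul0r msym0 subrr.
have [g /eqP e] : P 'X_[m].
  rewrite mpolyXE_id; apply: (big_ind P) => // j _.
  by elim: (m j) => [|k IH]; rewrite ?expr0 // exprS; apply: PM.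
exists (f@_m *: g + g'); apply/eqP; rewrite mulrDl -scalerAl e e'.
by rewrite msymD msymZ scalerBr addrACA opprD.
Qed.

(* The quotient (f - s_i f) / (x_i - x_{i+1}), unique since {mpoly rat[n]} is
   an integral domain. *)
Definition divided_difference i f : {mpoly rat[n]} :=
  xchoose (divided_difference_exists i f).

Lemma divided_differenceP i f :
  divided_difference i f * (x_this i - x_next i) = f - msym (simple i) f.
Proof. exact/eqP/(xchooseP (divided_difference_exists i f)). Qed.

End DividedDifferences.

Section Upsilon.
Variable n : nat.
Implicit Types (i : 'I_n.-1) (t : seq 'I_n.-1).

(* With 0-based a and b, the range 1 <= i <= j <= n - i reads
   a <= b and a.+1 + b.+1 <= n; in the symplectic case n is 2m. *)
Definition Upsilon_longest_O : {mpoly rat[n]} :=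
  \prod_(a < n) \prod_(b < n | (a <= b)%N && (a.+1 + b.+1 <= n)%N)
    ('X_a + 'X_b).

Definition Upsilon_longest_Sp : {mpoly rat[n]} :=
  \prod_(a < n) \prod_(b < n | (a < b)%N && (a.+1 + b.+1 <= n)%N)
    ('X_a + 'X_b).

(* Upsilon as computed along the word t; it is meaningful when t is a labelled
   path.  Upsilon_pi is the value at any labelled path ending at pi, and one
   exists by labelled_path_O_exists, resp. labelled_path_Sp_exists. *)
Fixpoint Upsilon_O t : {mpoly rat[n]} :=
  if t is i :: t' then
    if dashed_O i (path_end (@act_O n) t')
    then 2^-1 *: divided_difference i (Upsilon_O t')
    else divided_difference i (Upsilon_O t')
  else Upsilon_longest_O.

Fixpoint Upsilon_Sp t : {mpoly rat[n]} :=
  if t is i :: t' then divided_difference i (Upsilon_Sp t')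
  else Upsilon_longest_Sp.

End Upsilon.

Section Embeddings.
Variables (n N : nat) (le_nN : (n <= N)%N).

Definition mpoly_widen (f : {mpoly rat[n]}) : {mpoly rat[N]} :=
  f \mPo [tuple 'X_(widen_ord le_nN a) | a < n].

(* Extend a permutation of {1,...,n} to {1,...,N}, acting as [rest] on
   {n+1,...,N}. *)
Definition extend_fun (rest : 'I_N -> 'I_N) (w : 'S_n) (k : 'I_N) : 'I_N :=
  if insub (k : nat) is Some a then widen_ord le_nN (w a) else rest k.

Lemma extend_fun_inj (rest : 'I_N -> 'I_N) w : injective rest ->
  (forall k : 'I_N, n <= k -> n <= rest k)%N -> injective (extend_fun rest w).
Proof.
move=> rest_inj restP k l; rewrite /extend_fun.
case: insubP => [a _ ak|]; case: insubP => [b _ bl|]; rewrite -?leqNgt.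
- move/(congr1 val) => /= /val_inj/perm_inj ab.
  by apply: val_inj; rewrite /= -ak -bl ab.
- by move=> nl e; have := restP l nl; rewrite -e /= leqNgt ltn_ord.
- by move=> nk e; have := restP k nk; rewrite e /= leqNgt ltn_ord.
- by move=> _ _ /rest_inj.
Qed.

Lemma perm_iota_inj w : injective (extend_fun id w).
Proof. exact: extend_fun_inj. Qed.

Definition perm_iota (w : 'S_n) : 'S_N := perm (@perm_iota_inj w).

Lemma extend_fun_in rest w (k : 'I_N) (a : 'I_n) : k = a :> nat ->
  extend_fun rest w k = widen_ord le_nN (w a).
Proof. by move=> ka; rewrite /extend_fun ka valK. Qed.

Lemma extend_fun_out rest w (k : 'I_N) : (n <= k)%N ->
  extend_fun rest w k = rest k.
Proof. by move=> nk; rewrite /extend_fun insubN // -leqNgt. Qed.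

Lemma extend_funK (rest : 'I_N -> 'I_N) w : involutive rest ->
  (forall k : 'I_N, n <= k -> n <= rest k)%N -> w \in invol n ->
  involutive (extend_fun rest w).
Proof.
move=> restK restP /involP ww k; case: (ltnP k n) => [kn|nk].
  rewrite (@extend_fun_in _ _ k (Ordinal kn)) //.
  rewrite (@extend_fun_in _ _ _ (w (Ordinal kn))) // -permM ww perm1.
  exact: val_inj.
by rewrite (extend_fun_out _ _ nk) extend_fun_out ?restK // restP.
Qed.

Lemma perm_iota_invol w : w \in invol n -> perm_iota w \in invol N.
Proof.
move=> wI; apply/involP/permP => k; rewrite permM perm1 !permE.
exact: extend_funK.
Qed.

End Embeddings.

Section SymplecticEmbedding.
Variables (n N : nat) (le_nN : (n <= N)%N).

(* 0-based, the pairs (i, i+1) with i = 2n+1, 2n+3, ..., 2N-1 are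
   (k, k.+1) with k even. *)
Definition mate (k : nat) : nat := if odd k then k.-1 else k.+1.

Lemma mate_subproof (k : 'I_N.*2) : (mate k < N.*2)%N.
Proof. by rewrite /mate; have := ltn_ord k; case: ifP; lia. Qed.

Definition ord_mate (k : 'I_N.*2) : 'I_N.*2 := Ordinal (mate_subproof k).

Lemma ord_mateK : involutive ord_mate.
Proof. by move=> k; apply: val_inj; rewrite /= /mate; do 2?case: ifP; lia. Qed.

Lemma double_le : (n.*2 <= N.*2)%N.
Proof. by rewrite leq_double. Qed.

Lemma perm_iota_fpf_inj w : injective (extend_fun double_le ord_mate w).
Proof.
apply: extend_fun_inj; first exact: inv_inj ord_mateK.
by move=> k; rewrite /= /mate; case: ifP; lia.
Qed.

Definition perm_iota_fpf (w : 'S_(n.*2)) : 'S_(N.*2) := perm (@perm_iota_fpf_inj w).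

Lemma perm_iota_fpf_invol w :
  w \in invol_fpf n.*2 -> perm_iota_fpf w \in invol_fpf N.*2.
Proof.
rewrite inE => /andP[wI /forallP fpf]; rewrite inE; apply/andP; split.
  apply/involP/permP => k; rewrite permM perm1 !permE.
  apply: extend_funK => //; first exact: ord_mateK.
  by move=> l; rewrite /= /mate; case: ifP; lia.
apply/forallP => k; rewrite permE; case: (ltnP k n.*2) => [kn|nk].
  rewrite (@extend_fun_in _ _ _ _ _ k (Ordinal kn)) //.
  by have := fpf (Ordinal kn); rewrite -!val_eqE.
by rewrite extend_fun_out // -val_eqE /= /mate; case: ifP; lia.
Qed.

End SymplecticEmbedding.

(* Main.v *)
Require Import Defs.
From mathcomp Require Import all_boot all_fingroup all_algebra.
From mathcomp Require Import mpoly zify ring.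

(** Taking n = N, both identities say in particular that the value computed
    along a labelled path depends on its endpoint only, so path independence
    has to be proved together with stability.

    Reading paths from the endpoint w up to w_0, there is exactly one edge
    labelled i above w for each ascent i of w, and its upper end is [up i w];
    a path is thus a word [t] with [climb w t], in the orthogonal and in the
    symplectic case alike.  Every factor 2 x_a of Upsilon at w_0 is split as 2
    times x_a.  The number of these factors is the number of 2-cycles of w_0, a
    dashed edge turns one 2-cycle into two fixed points, and a solid edge keeps
    the cycle type; hence Upsilon at w is 2^c times the plain composite of
    divided differences applied to the product, over unordered pairs {a, b}
    with a <= b in the staircase, of the sum of the variables in {a, b}, where
    c is the number of 2-cycles of w ([Upsilon_O_word]).  In the symplectic
    case the staircase has no diagonal and no edge is dashed.

    Path independence ([climb_path_independent]) goes by induction downwards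
    from w_0.  Two paths leaving w by distinct ascents i and j have to be
    compared.  The orbit of w under s_i and s_j is a cycle with w as its only
    minimum, and going around it yields the commutation or the braid relation
    of divided differences, except in two degenerate cases: w conjugates s_i to
    s_j, or j = i + 1 and w fixes i, i + 1, i + 2.  In those cases i and j are
    linked by nondegenerate orbits through other ascents of w, if w has enough
    of them.  If not, w is nearly w_0: it is one edge below w_0, or w_0 with its
    middle three or middle four values put back in increasing order.  Only
    these three configurations need an identity on the polynomial at w_0.  All
    of them hold because d_i erases from a product of sums of variables a factor
    that contains x_i but not x_{i+1}, as soon as the remaining factors are
    permuted by s_i
    ([divided_difference_prod_var_sums]).

    Stability reduces to passing from n to n + 1 (from 2m to 2m + 2).  A climb
    of w is also a climb of its extension, up to w_0 of the smaller group
    extended by the embedding ([climb_extends]), and an explicit climb from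
    there to the larger w_0 erases, one factor at a time, precisely the factors
    which the larger staircase has in excess ([climb_moved_fixed_point],
    [climb_moved_exchange]). *)

Set Implicit Arguments.
Unset Strict Implicit.
Unset Printing Implicit Defensive.

Import GRing.Theory.
Local Open Scope ring_scope.

(* Equality tests nested inside one another are decided from the inside out,
   and branches with contradictory hypotheses are pruned on the way. *)
Ltac split_eqs := repeat match goal with
  | |- context [if ?a == ?b :> nat then _ else _] =>
      lazymatch constr:((a, b)) with
      | context [if _ then _ else _] => fail
      | _ => case: (@eqP _ a b) => ? /=; try (exfalso; lia)
      end
  end.

Ltac split_ifs := repeat (case: ifP => ?).

(** * Divided differences *)

Section DividedDifferenceTheory.
Variable n : nat.
Implicit Types (i j : 'I_n.-1) (f g : {mpoly rat[n]}).

Lemma msymXU (s : 'S_n) a : msym s 'X_a = 'X_(s a) :> {mpoly rat[n]}.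
Proof. by rewrite /msym mmapX mmap1U. Qed.

Lemma mpolyXU_inj : injective (fun a : 'I_n => 'X_a : {mpoly rat[n]}).
Proof.
move=> a b /(congr1 (mcoeff U_(a))); rewrite !mcoeffX eqxx.
by case: eqP => [/mnmP/(_ a)|_ /eqP]; rewrite ?oner_eq0 // !mnm1E eqxx; case: eqP.
Qed.

Lemma this_neq_next i : ord_this i != ord_next i.
Proof. by rewrite -val_eqE /= neq_ltn ltnSn. Qed.

Lemma x_diff_neq0 i : x_this i - x_next i != 0.
Proof. by rewrite subr_eq0 (inj_eq mpolyXU_inj) this_neq_next. Qed.

Lemma divided_difference_unique i f g :
  g * (x_this i - x_next i) = f - msym (simple i) f ->
  divided_difference i f = g.
Proof.
by rewrite -divided_differenceP => /(mulIf (x_diff_neq0 i)) ->.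
Qed.

Lemma divided_differenceZ i c f :
  divided_difference i (c *: f) = c *: divided_difference i f.
Proof.
apply: divided_difference_unique.
by rewrite -scalerAl divided_differenceP scalerBr msymZ.
Qed.

Lemma divided_difference_sym i f : msym (simple i) f = f ->
  divided_difference i f = 0.
Proof. by move=> fs; apply: divided_difference_unique; rewrite fs mul0r subrr. Qed.

Lemma divided_differenceMl i g f : msym (simple i) g = g ->
  divided_difference i (g * f) = g * divided_difference i f.
Proof.
move=> gs; apply: divided_difference_unique.
by rewrite -mulrA divided_differenceP mulrBr msymM gs.
Qed.

Lemma msym_x_this i : msym (simple i) (x_this i) = x_next i.
Proof. by rewrite msymXU /simple tpermL. Qed.

Lemma msym_x_next i : msym (simple i) (x_next i) = x_this i.
Proof. by rewrite msymXU /simple tpermR. Qed.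

Lemma msym_divided_difference i f :
  msym (simple i) (divided_difference i f) = divided_difference i f.
Proof.
apply: (mulIf (x_diff_neq0 i)); rewrite divided_differenceP.
have := congr1 (msym (simple i)) (divided_differenceP i f).
rewrite msymM !msymB -msymMm simpleK msym1m msym_x_this msym_x_next.
by move=> e; rewrite -opprB mulrN e opprB.
Qed.

Lemma simple_far i j : (i.+1 < j)%N || (j.+1 < i)%N ->
  simple i (ord_this j) = ord_this j /\ simple i (ord_next j) = ord_next j.
Proof.
by move=> ij; split; apply: val_inj; rewrite /= simple_val /=;
   split_eqs; lia.
Qed.

Lemma simple_commute i j : (i.+1 < j)%N || (j.+1 < i)%N ->
  (simple i * simple j = simple j * simple i)%g.
Proof.
move=> ij; apply/permP => a; apply: val_inj; rewrite !permM /= !simple_val.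
by split_eqs; lia.
Qed.

Lemma divided_difference_commute i j f : (i.+1 < j)%N || (j.+1 < i)%N ->
  divided_difference i (divided_difference j f)
  = divided_difference j (divided_difference i f).
Proof.
move=> ij.
have far (k l : 'I_n.-1) : (k.+1 < l)%N || (l.+1 < k)%N ->
    msym (simple k) (x_this l - x_next l) = x_this l - x_next l.
  by move=> kl; rewrite msymB !msymXU; have [-> ->] := simple_far kl.
have expand (k l : 'I_n.-1) : (k.+1 < l)%N || (l.+1 < k)%N ->
    divided_difference k (divided_difference l f) * (x_this k - x_next k)
      * (x_this l - x_next l)
    = f - msym (simple l) f - msym (simple k) f
      + msym (simple l * simple k)%g f.
  move=> kl; rewrite divided_differenceP mulrBl divided_differenceP.
  have -> : msym (simple k) (divided_difference l f) * (x_this l - x_next l) =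
      msym (simple k) (divided_difference l f * (x_this l - x_next l)).
    by rewrite msymM far.
  by rewrite divided_differenceP msymB -msymMm opprB addrA [LHS]addrAC.
apply: (mulIf (x_diff_neq0 i)); apply: (mulIf (x_diff_neq0 j)).
apply: etrans (expand i j ij) _; apply: etrans; last exact: mulrAC.
apply: etrans; last by symmetry; apply: expand; rewrite orbC.
have swap (a b c d : {mpoly rat[n]}) : a - b - c + d = a - c - b + d.
  by rewrite (addrAC a).
rewrite (simple_commute ij); exact: swap.
Qed.

Lemma simple_braid i j : j = i.+1 :> nat ->
  (simple i * simple j * simple i = simple j * simple i * simple j)%g.
Proof.
move=> ji; apply/permP => a; apply: val_inj; rewrite !permM.
by rewrite /= !simple_val ji; split_eqs; lia.
Qed.

(** The numerator of a threefold divided difference.  With d1, d2 and d the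
    three differences of x_i, x_{i+1}, x_{i+2}, the right-hand side is the
    alternating sum of the six images of f, hence insensitive to exchanging
    the two simple transpositions; this is why the braid relation holds.  The
    statement is kept over an arbitrary ring, where the algebra is light. *)
Lemma triple_quotient (R : comNzRingType) (d1 d2 d k h h' g g1 g2 : R)
    (f f1 f2 f3 f4 f5 : R) :
  d1 + d2 = d ->
  k * d1 = h - h' -> h * d2 = g - g1 -> h' * d = g - g2 ->
  g * d1 = f - f1 -> g1 * d = f2 - f3 -> g2 * d2 = f4 - f5 ->
  k * (d1 * d2 * d) = f - f1 - f2 + f3 + f4 - f5.
Proof.
move=> ed ek eh eh' eg eg1 eg2.
have -> : k * (d1 * d2 * d) = k * d1 * d2 * d by ring.
have -> : k * d1 * d2 * d = (h * d2) * d - (h' * d) * d2 by rewrite ek; ring.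
rewrite eh eh'.
have -> : (g - g1) * d - (g - g2) * d2 = g * d1 - g1 * d + g2 * d2.
  by rewrite -ed; ring.
by rewrite eg eg1 eg2; ring.
Qed.

Lemma divided_difference_braid i j f : j = i.+1 :> nat ->
  divided_difference i (divided_difference j (divided_difference i f))
  = divided_difference j (divided_difference i (divided_difference j f)).
Proof.
move=> ji; have ji' : ord_this j = ord_next i by apply: val_inj.
pose A := x_this i; pose B := x_next i; pose C := x_next j.
have xj : x_this j = B by rewrite /x_this ji'.
have iC : simple i (ord_next j) = ord_next j.
  by apply: val_inj; rewrite /= simple_val /= ji; split_eqs; lia.
have jA : simple j (ord_this i) = ord_this i.
  by apply: val_inj; rewrite /= simple_val /= ji; split_eqs; lia.
have siC : msym (simple i) C = C by rewrite msymXU iC.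
have sjA : msym (simple j) A = A by rewrite msymXU jA.
have sjB : msym (simple j) B = C by rewrite -xj msym_x_this.
have sjC : msym (simple j) C = B by rewrite msym_x_next.
have dd : (A - B) + (B - C) = A - C by rewrite addrA subrK.
have dd' : (B - C) + (A - B) = A - C by rewrite -dd; apply: addrC.
have AC : A - C != 0.
  by rewrite subr_eq0 (inj_eq mpolyXU_inj) -val_eqE /= ji; lia.
have := x_diff_neq0 i; have := x_diff_neq0 j; rewrite xj -/A -/B -/C => BC AB.
have ddi g : divided_difference i g * (A - B) = g - msym (simple i) g.
  exact: divided_differenceP.
have ddj g : divided_difference j g * (B - C) = g - msym (simple j) g.
  by rewrite -xj; apply: divided_differenceP.
have sj1 : msym (simple j) (A - B) = A - C by rewrite msymB sjA sjB.
have si1 : msym (simple i) (B - C) = A - C by rewrite msymB siC msym_x_next.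
have ji1 : msym (simple i) (A - C) = B - C by rewrite msymB siC msym_x_this.
have ij1 : msym (simple j) (A - C) = A - B by rewrite msymB sjA sjC.
have ddi' g : msym (simple j) (divided_difference i g) * (A - C) =
    msym (simple j) g - msym (simple i * simple j)%g g.
  by rewrite -sj1 -msymM ddi msymB -msymMm.
have ddj' g : msym (simple i) (divided_difference j g) * (A - C) =
    msym (simple i) g - msym (simple j * simple i)%g g.
  by rewrite -si1 -msymM ddj msymB -msymMm.
have ddi'' g : msym (simple j * simple i)%g (divided_difference i g) * (B - C) =
    msym (simple j * simple i)%g g - msym (simple i * simple j * simple i)%g g.
  by rewrite msymMm -ji1 -msymM ddi' msymB -!msymMm.
have ddj'' g : msym (simple i * simple j)%g (divided_difference j g) * (A - B) =
    msym (simple i * simple j)%g g - msym (simple j * simple i * simple j)%g g.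
  by rewrite msymMm -ij1 -msymM ddj' msymB -!msymMm.
have Dneq : (A - B) * (B - C) * (A - C) != 0 by rewrite !mulf_neq0.
pose gi := divided_difference i f; pose gj := divided_difference j f.
have gis : msym (simple i) gi = gi := msym_divided_difference i f.
have gjs : msym (simple j) gj = gj := msym_divided_difference j f.
have hi' : msym (simple i) (divided_difference j gi) * (A - C) =
    gi - msym (simple j * simple i)%g gi.
  by apply: etrans (ddj' gi) _; apply: (congr1 (+%R^~ _) gis).
have hj' : msym (simple j) (divided_difference i gj) * (A - C) =
    gj - msym (simple i * simple j)%g gj.
  by apply: etrans (ddi' gj) _; apply: (congr1 (+%R^~ _) gjs).
have Ei := triple_quotient dd (ddi _) (ddj gi) hi' (ddi f) (ddi' f) (ddi'' f).
have Ej := triple_quotient dd' (ddj _) (ddi gj) hj' (ddj f) (ddj' f) (ddj'' f).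
have shuffle (R : comNzRingType) (a b c d e g : R) :
  a - b - c + d + e - g = a - c - b + e + d - g by ring.
apply: (mulIf Dneq); rewrite [X in X * (A - C)]mulrC in Ej.
apply: etrans Ei _; apply: etrans (esym Ej).
by rewrite (simple_braid ji); apply: shuffle.
Qed.

End DividedDifferenceTheory.

(** * Erasing factors from products of sums of variables *)

Definition swap_nat (i x : nat) : nat :=
  if x == i then i.+1 else if x == i.+1 then i else x.

Lemma swap_natL i : swap_nat i i = i.+1.
Proof. by rewrite /swap_nat eqxx. Qed.

Lemma swap_natR i : swap_nat i i.+1 = i.
Proof. by rewrite /swap_nat eqxx; case: eqP => //; lia. Qed.

Lemma swap_natD i x : x != i -> x != i.+1 -> swap_nat i x = x.
Proof. by rewrite /swap_nat => /negbTE -> /negbTE ->. Qed.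

Lemma swap_natK i : involutive (swap_nat i).
Proof. by move=> x; rewrite /swap_nat; split_eqs; lia. Qed.

Lemma swap_nat_below i : swap_nat i.+1 i = i.
Proof. by rewrite swap_natD //; lia. Qed.

Lemma swap_nat_above i : swap_nat i i.+2 = i.+2.
Proof. by rewrite swap_natD //; lia. Qed.

Definition swapE := (swap_natL, swap_natR, swap_nat_below, swap_nat_above).

Section PairProducts.
Variable n : nat.
Implicit Types (i : 'I_n.-1) (A : {set 'I_n}) (S T : {set {set 'I_n}}).
Implicit Types (r : rel nat).

Definition var_sum A : {mpoly rat[n]} := \sum_(a in A) 'X_a.

Definition prod_var_sums S : {mpoly rat[n]} := \prod_(A in S) var_sum A.

Lemma msym_var_sum (s : 'S_n) A : msym s (var_sum A) = var_sum (s @: A).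
Proof.
rewrite /var_sum big_imset /=; last by move=> a b _ _; apply: perm_inj.
by rewrite raddf_sum; apply: eq_bigr => a _; apply: msymXU.
Qed.

Lemma msym_prod_var_sums (s : 'S_n) S : (forall A, A \in S -> s @: A \in S) ->
  msym s (prod_var_sums S) = prod_var_sums S.
Proof.
move=> stable; pose f A := s @: A.
have f_inj : injective f by apply: imset_inj; apply: perm_inj.
have fS : f @: S = S.
  apply/eqP; rewrite eqEcard card_imset // leqnn andbT.
  by apply/subsetP => _ /imsetP[A AS ->]; apply: stable.
rewrite /prod_var_sums -{2}fS big_imset /=; last by move=> A B _ _; apply: f_inj.
by rewrite rmorph_prod; apply: eq_bigr => A _; apply: msym_var_sum.
Qed.

(** Since s_i fixes the product of the other factors, d_i only sees the factor
    of A, whose difference with its image under s_i is x_i - x_{i+1}. *)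
Lemma divided_difference_prod_var_sums i S A : A \in S ->
  ord_this i \in A -> ord_next i \notin A ->
  (forall B, B \in S :\ A -> simple i @: B \in S :\ A) ->
  divided_difference i (prod_var_sums S) = prod_var_sums (S :\ A).
Proof.
move=> AS iA i1A /msym_prod_var_sums stable.
rewrite /prod_var_sums (big_setD1 A AS) /= -/(prod_var_sums (S :\ A)) mulrC.
rewrite divided_differenceMl // -[RHS]mulr1; congr (_ * _).
apply: divided_difference_unique; rewrite mul1r msym_var_sum /var_sum.
have -> : simple i @: A = ord_next i |: A :\ ord_this i.
  apply/setP => b; rewrite -{1}[b](tpermK (ord_this i) (ord_next i)) -/(simple i).
  rewrite mem_imset; last exact: perm_inj.
  rewrite !inE /simple; case: tpermP => [->|->|/eqP b1 /eqP b2].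
  - by rewrite eqxx (negbTE i1A) (negbTE (this_neq_next i)).
  - by rewrite eqxx iA.
  - by rewrite (negbTE b1) (negbTE b2).
rewrite (big_setD1 _ iA) big_setU1 /=; last by rewrite !inE (negbTE i1A) andbF.
by rewrite opprD addrACA subrr addr0.
Qed.

(** Unordered pairs are encoded as sets of indices, so that a diagonal pair is a
    singleton and contributes x_a rather than 2 x_a: erasing it then needs no
    factor 1/2. *)
Definition pairs r : {set {set 'I_n}} :=
  [set A | [exists a : 'I_n, exists b : 'I_n, (A == [set a; b]) && r a b]].

Definition pair_product r : {mpoly rat[n]} := prod_var_sums (pairs r).

Lemma pairsP r A :
  reflect (exists a b : 'I_n, A = [set a; b] /\ r a b) (A \in pairs r).
Proof.
rewrite inE; apply: (iffP existsP) => [[a /existsP[b /andP[/eqP -> rab]]]|].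
  by exists a, b.
by move=> [a [b [-> rab]]]; exists a; apply/existsP; exists b; rewrite eqxx.
Qed.

Lemma eq_pair_product r r' :
  (forall a b, (a < n)%N -> (b < n)%N -> r a b = r' a b) ->
  pair_product r = pair_product r'.
Proof.
move=> rr'; congr (prod_var_sums _); apply/setP => A; rewrite !inE.
by apply: eq_existsb => a; apply: eq_existsb => b; rewrite rr'.
Qed.

Definition stable_under (k : nat) r :=
  forall a b, (a < n)%N -> (b < n)%N -> r a b -> r (swap_nat k a) (swap_nat k b).

Lemma simple_swap_nat i (a : 'I_n) : simple i a = swap_nat i a :> nat.
Proof. exact: simple_val. Qed.

Lemma pairs_stable i r : stable_under i r ->
  forall A, A \in pairs r -> simple i @: A \in pairs r.
Proof.
move=> st A /pairsP[a [b [-> rab]]]; apply/pairsP.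
exists (simple i a), (simple i b); rewrite imsetU1 imset_set1; split=> //.
by rewrite !simple_swap_nat; apply: st.
Qed.

Lemma msym_pair_product i r : stable_under i r ->
  msym (simple i) (pair_product r) = pair_product r.
Proof. by move/pairs_stable/msym_prod_var_sums. Qed.

Lemma set2_eq (a b c d : 'I_n) : [set a; b] = [set c; d] ->
  (a = c /\ b = d) \/ (a = d /\ b = c).
Proof.
move=> e; have /set2P ha : a \in [set c; d] by rewrite -e set21.
have /set2P hb : b \in [set c; d] by rewrite -e set22.
have /set2P hc : c \in [set a; b] by rewrite e set21.
have /set2P hd : d \in [set a; b] by rewrite e set22.
case: ha hb hc hd => -> [] -> hc hd; auto.
- by case: hd => ->; auto.
- by case: hc => ->; auto.
Qed.

Lemma divided_difference_pair_product i (q : nat) r r' :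
  (q < n)%N -> q != i.+1 -> r' i q = false -> r' q i = false ->
  stable_under i r' ->
  (forall a b, (a < n)%N -> (b < n)%N ->
     r a b = r' a b || (a == i) && (b == q) || (a == q) && (b == i)) ->
  divided_difference i (pair_product r) = pair_product r'.
Proof.
move=> qn qi nr1 nr2 st rE; pose q' := Ordinal qn; pose A := [set ord_this i; q'].
have AS : A \in pairs r.
  apply/pairsP; exists (ord_this i), q'; split=> //.
  by rewrite rE ?ltn_ord //= !eqxx orbT.
have SA : pairs r :\ A = pairs r'.
  apply/setP => B; apply/setD1P/pairsP => [[BA /pairsP[a [b [e rab]]]]|].
    exists a, b; split=> //; move: rab; rewrite rE //; case: (r' a b) => //=.
    case/orP => /andP[/eqP ea /eqP eb]; case/eqP: BA; rewrite e /A.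
      by congr [set _; _]; apply: val_inj.
    by rewrite setUC; congr [set _; _]; apply: val_inj.
  move=> [a [b [-> rab]]]; split; last first.
    by apply/pairsP; exists a, b; rewrite rE // rab.
  by apply/eqP => /set2_eq[] [ea eb]; move: rab; rewrite ea eb /= ?nr1 ?nr2.
rewrite /pair_product -SA; apply: divided_difference_prod_var_sums => //.
- by rewrite !inE eqxx.
- by rewrite !inE -!val_eqE /= eqn_leq ltnn /= eq_sym.
- by rewrite SA; apply: pairs_stable.
Qed.

End PairProducts.

(** * Climbing to the longest element *)

Section NatModel.
Variable n : nat.
Implicit Types (i j : 'I_n.-1) (u w : 'S_n).

(** Permutations extended by the identity to all naturals: this allows
    arithmetic on labels and a common language for different n. *)
Definition permn w (x : nat) : nat :=
  if insub x is Some a then val (w a : 'I_n) else x.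

Lemma permn_ord w (a : 'I_n) : permn w a = w a.
Proof. by rewrite /permn valK. Qed.

Lemma permn_out w x : (n <= x)%N -> permn w x = x.
Proof. by move=> nx; rewrite /permn insubN // -leqNgt. Qed.

Lemma permn_lt w x : (permn w x < n)%N = (x < n)%N.
Proof.
case: (ltnP x n) => [xn|nx]; last by rewrite permn_out // ltnNge nx.
by rewrite (permn_ord w (Ordinal xn)) ltn_ord.
Qed.

Lemma permnM u w x : permn (u * w)%g x = permn w (permn u x).
Proof.
case: (ltnP x n) => [xn|nx]; last by rewrite !permn_out.
by rewrite (permn_ord _ (Ordinal xn)) (permn_ord u (Ordinal xn)) permn_ord permM.
Qed.

Lemma permn1 x : permn 1%g x = x.
Proof.
case: (ltnP x n) => [xn|nx]; last by rewrite !permn_out.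
by rewrite (permn_ord _ (Ordinal xn)) perm1.
Qed.

Lemma permn_inj w : injective (permn w).
Proof.
by apply: (can_inj (g := permn w^-1%g)) => x; rewrite -permnM mulgV permn1.
Qed.

Lemma eq_permn u w : (forall x, (x < n)%N -> permn u x = permn w x) -> u = w.
Proof.
move=> e; apply/permP => a; apply: val_inj.
by have := e a (ltn_ord a); rewrite !permn_ord.
Qed.

Lemma permn_simple i x : permn (simple i) x = swap_nat i x.
Proof.
case: (ltnP x n) => [xn|nx].
  by rewrite (permn_ord _ (Ordinal xn)) simple_swap_nat.
rewrite permn_out // /swap_nat; have := ltn_ord i; split_eqs; lia.
Qed.

Lemma permn_longest x : (x < n)%N -> permn (longest n) x = (n - x.+1)%N.
Proof. by move=> xn; rewrite (permn_ord _ (Ordinal xn)) permE. Qed.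

Lemma permn_invol w : w \in invol n -> involutive (permn w).
Proof. by move/involP => ww x; rewrite -permnM ww permn1. Qed.

Definition ascent i w : bool := (permn w i < permn w i.+1)%N.

Definition fixes_pair i w : bool := (permn w i == i) && (permn w i.+1 == i.+1).

(** For an ascent i of w, the upper end of the edge labelled i above w; the edge
    is dashed exactly when w fixes both i and i + 1. *)
Definition up i w : 'S_n :=
  if fixes_pair i w then (w * simple i)%g else conj_simple i w.

Lemma permn_conj i w x :
  permn (conj_simple i w) x = swap_nat i (permn w (swap_nat i x)).
Proof. by rewrite !permnM !permn_simple. Qed.

Lemma permn_up i w x :
  permn (up i w) x =
  swap_nat i (permn w (if fixes_pair i w then x else swap_nat i x)).
Proof. by rewrite /up; case: ifP => _; rewrite !permnM !permn_simple. Qed.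

Lemma up_conj i w : fixes_pair i w = false -> up i w = conj_simple i w.
Proof. by rewrite /up => ->. Qed.

Lemma up_mul i w : fixes_pair i w -> up i w = (w * simple i)%g.
Proof. by rewrite /up => ->. Qed.

End NatModel.

Section Climbing.
Variable n : nat.
Implicit Types (i j : 'I_n.-1) (u w : 'S_n) (t : seq 'I_n.-1).

Fixpoint climb w t : bool :=
  if t is i :: t' then ascent i w && climb (up i w) t' else w == longest n.

Lemma ascentE i w : ascent i w = (w (ord_this i) < w (ord_next i))%N.
Proof. by rewrite /ascent -!permn_ord. Qed.

Lemma ascentN i w : ~~ ascent i w -> (permn w i.+1 < permn w i)%N.
Proof.
rewrite /ascent -leqNgt leq_eqVlt => /orP[/eqP/permn_inj|//].
by move/esym/n_Sn.
Qed.

Lemma no_ascent w : (forall i, ~~ ascent i w) -> w = longest n.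
Proof.
move=> noasc; case: (eqVneq w (longest n)) => // /not_longest_ascent[i].
by rewrite -ascentE (negbTE (noasc i)).
Qed.

Lemma longest_invol : longest n \in invol n.
Proof. by apply/involP/permP => a; rewrite permM !permE rev_ordK. Qed.

Lemma conj_simple_id i w : permn w i = i /\ permn w i.+1 = i.+1 \/
  permn w i = i.+1 /\ permn w i.+1 = i -> conj_simple i w = w.
Proof.
move=> wi; apply: eq_permn => x _; rewrite permn_conj.
case: (eqVneq x i) => [->|xi].
  by case: wi => -[e1 e2]; rewrite swap_natL e2 ?swap_natL ?swap_natR e1.
case: (eqVneq x i.+1) => [->|xi1].
  by case: wi => -[e1 e2]; rewrite swap_natR e1 ?swap_natL ?swap_natR e2.
rewrite (swap_natD xi xi1); apply: swap_natD.
  by case: wi => -[e1 e2]; [rewrite -[X in _ != X]e1 | rewrite -[X in _ != X]e2];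
    rewrite (inj_eq (@permn_inj _ w)).
by case: wi => -[e1 e2]; [rewrite -[X in _ != X]e2 | rewrite -[X in _ != X]e1];
  rewrite (inj_eq (@permn_inj _ w)).
Qed.

Lemma ascent_conj_fix i w : ascent i w -> w \in invol n ->
  (conj_simple i w == w) = fixes_pair i w.
Proof.
move=> asc /permn_invol wK; apply/eqP/andP => [e|[/eqP e1 /eqP e2]].
  have := permn_conj i w i; have := permn_conj i w i.+1; rewrite e.
  rewrite swap_natL swap_natR; move: asc; rewrite /ascent /swap_nat.
  split_eqs; rewrite ?eqxx //; lia.
by apply: conj_simple_id; left.
Qed.

Lemma up_invol i w : w \in invol n -> ascent i w -> up i w \in invol n.
Proof.
move=> wI asc; rewrite /up -(ascent_conj_fix asc wI).
case: eqP => [e|_]; last exact: conj_invol.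
apply/involP; rewrite -{1}e /conj_simple -(mulgA (simple i * w)%g).
rewrite simpleK mulg1 mulgA -(mulgA (simple i)) (involP _ wI) mulg1.
exact: simpleK.
Qed.

Lemma up_length i w : w \in invol n -> ascent i w ->
  (coxeter_length w < coxeter_length (up i w))%N.
Proof.
move=> wI asc; have := asc; rewrite ascentE => asc'.
have [_ l2] := ascent_length wI asc'; rewrite /up -(ascent_conj_fix asc wI).
case: (eqVneq (conj_simple i w) w) => [_|nc]; first by rewrite l2.
by have [-> _] := ascent_conj wI asc' nc.
Qed.

Lemma ascent_raises i w : w \in invol n -> ascent i w -> raises i w.
Proof. by rewrite ascentE => wI /(ascent_length wI)[_]; rewrite /raises => ->. Qed.

(** Each operation that changes an involution is undone by [up], which is
    therefore the only way to climb along a given label. *)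
Lemma act_O_up i w' : w' \in invol n -> act_O i w' != w' ->
  let w := act_O i w' in
  [/\ w \in invol n, ascent i w, up i w = w' & dashed_O i w' = fixes_pair i w].
Proof.
move=> w'I; rewrite /act_O /dashed_O; case: ifPn => [_|nr _ /=]; first by rewrite eqxx.
have /ascentN desc : ~~ ascent i w' by apply: contra nr; apply: ascent_raises.
have wK := permn_invol w'I.
case: eqVneq => [e|ne] /=.
  have [e1 e2] : permn w' i = i.+1 /\ permn w' i.+1 = i.
    have := permn_conj i w' i; have := permn_conj i w' i.+1; rewrite e.
    by rewrite swap_natL swap_natR; move: desc; rewrite /swap_nat; split_eqs; lia.
  have fp : fixes_pair i (w' * simple i)%g.
    by rewrite /fixes_pair !permnM !permn_simple e1 e2 swap_natL swap_natR !eqxx.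
  split=> //.
  - apply/involP; rewrite -{1}e /conj_simple -!mulgA (mulgA (simple i) (simple i)).
    by rewrite simpleK mul1g (mulgA w') (involP _ w'I) mul1g simpleK.
  - by rewrite /ascent !permnM !permn_simple e1 e2 swap_natL swap_natR.
  - by rewrite /up fp -mulgA simpleK mulg1.
have asc : ascent i (conj_simple i w').
  rewrite /ascent !permn_conj swap_natL swap_natR.
  have nsw : ~ (permn w' i = i.+1 /\ permn w' i.+1 = i).
    by move=> e12; case/eqP: ne; apply: conj_simple_id; right.
  by move: desc; rewrite /swap_nat; split_eqs; lia.
have nfp : fixes_pair i (conj_simple i w') = false.
  apply/negP; rewrite /fixes_pair !permn_conj swap_natL swap_natR.
  by move: desc; rewrite /swap_nat; split_eqs; lia.
split=> //; first exact: conj_invol.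
by rewrite /up nfp /conj_simple !mulgA simpleK mul1g -mulgA simpleK mulg1.
Qed.

Lemma path_O_invol_climb t : all_steps_change (@act_O n) t ->
  path_end (@act_O n) t \in invol n /\ climb (path_end (@act_O n) t) t.
Proof.
elim: t => [|i t IH] /=; first by rewrite longest_invol eqxx.
case/andP=> ne /IH[pI c]; have [wI asc e _] := act_O_up pI ne.
by rewrite wI asc e.
Qed.

Lemma labelled_path_O_climb w t : labelled_path (@act_O n) w t -> climb w t.
Proof. by case/andP=> /path_O_invol_climb[_ c] /eqP <-. Qed.

(** The two operations differ only along dashed edges, where the symplectic one
    is trivial. *)
Lemma path_Sp_O t : all_steps_change (@act_Sp n) t ->
  all_steps_change (@act_O n) t
  /\ path_end (@act_Sp n) t = path_end (@act_O n) t.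
Proof.
elim: t => //= i t IH /andP[ne /IH[c e]]; move: ne; rewrite e c andbT.
set p := path_end _ _; rewrite /act_Sp /act_O.
case: (raises i p); first by rewrite eqxx.
by case: (eqVneq (conj_simple i p) p) => [_|ne] /=; rewrite ?eqxx.
Qed.

Lemma labelled_path_Sp_climb w t : labelled_path (@act_Sp n) w t -> climb w t.
Proof.
case/andP=> /path_Sp_O[c e] we; apply: labelled_path_O_climb.
by rewrite /labelled_path c -e.
Qed.

Lemma climb_exists w : w \in invol n -> exists t, climb w t.
Proof.
by move/labelled_path_O_exists => [t /labelled_path_O_climb]; exists t.
Qed.

End Climbing.

(** * Rank two orbits *)

Section LocalRelations.
Variable n : nat.
Implicit Types (i j k : 'I_n.-1) (w : 'S_n).

Definition apart i j : bool := (i.+1 < j)%N || (j.+1 < i)%N.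

(** For ascents i and j of an involution w, conjugation by w maps s_i to s_j
    exactly in this situation; if moreover s_i and s_j commute, the two edges
    have the same upper end. *)
Definition exchanges w i j : bool := (permn w i == j) && (permn w i.+1 == j.+1).

Lemma exchangesC w i j : w \in invol n -> exchanges w i j = exchanges w j i.
Proof.
move/permn_invol => wK.
have sym a b : (permn w a == b) -> (permn w b == a) by move/eqP <-; rewrite wK.
by apply/andP/andP => -[/sym -> /sym ->].
Qed.

Lemma ascent_up_apart w i j : apart i j -> ascent j w -> ~~ exchanges w j i ->
  ascent j (up i w) /\ fixes_pair j (up i w) = fixes_pair j w.
Proof.
rewrite /apart /exchanges /ascent /fixes_pair => ij asc nex.
rewrite !permn_up.
have fix1 : (if fixes_pair i w then j : nat else swap_nat i j) = j.
  by case: ifP => // _; rewrite swap_natD //; lia.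
have fix2 : (if fixes_pair i w then j.+1 else swap_nat i j.+1) = j.+1.
  by case: ifP => // _; rewrite swap_natD //; lia.
rewrite fix1 fix2; move: asc nex; rewrite /swap_nat.
by split; split_eqs; lia.
Qed.

(** As i and j are apart and not exchanged, moving along one label changes
    neither the ascent nor the kind of edge at the other. *)
Lemma diamond w i j : w \in invol n -> apart i j -> ascent i w -> ascent j w ->
  ~~ exchanges w i j ->
  [/\ ascent j (up i w), ascent i (up j w) & up j (up i w) = up i (up j w)].
Proof.
move=> wI ij asci ascj nex.
have [a1 f1] : ascent j (up i w) /\ fixes_pair j (up i w) = fixes_pair j w.
  by apply: ascent_up_apart; rewrite // exchangesC.
have ji : apart j i by rewrite /apart orbC.
have [a2 f2] : ascent i (up j w) /\ fixes_pair i (up j w) = fixes_pair i w.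
  exact: ascent_up_apart.
split=> //; have c := simple_commute ij.
rewrite {1}/up f1 [RHS]/up f2 /up /conj_simple.
case: (fixes_pair i w); case: (fixes_pair j w); rewrite -?mulgA ?c //.
by rewrite mulgA -c -mulgA.
Qed.

(** Among three edges, one is dashed on each side of the hexagon: the first on
    one side, the last on the other.  The next two lemmas are the mirror case
    and the case of solid edges only. *)
Lemma hexagon_fixed_left w i j : j = i.+1 :> nat -> ascent j w ->
  fixes_pair i w -> permn w j.+1 != j.+1 ->
  [/\ ascent j (up i w), ascent i (up j (up i w)),
      ascent i (up j w), ascent j (up i (up j w))
    & up i (up j (up i w)) = up j (up i (up j w))].
Proof.
move=> ji; rewrite /ascent ji => ascj fi nf; have := fi.
rewrite {1}/fixes_pair => /andP[/eqP e1 /eqP e2].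
have fj : fixes_pair j w = false by rewrite /fixes_pair ji (negbTE nf) andbF.
have u1 : up i w = (w * simple i)%g by rewrite /up fi.
have u2 : up j w = conj_simple j w by rewrite /up fj.
have v1 : up j (up i w) = conj_simple j (up i w).
  apply: up_conj; rewrite u1 /fixes_pair ji !permnM !permn_simple ?ji ?swapE e2.
  by rewrite /swap_nat; split_eqs; lia.
have v2 : up i (up j w) = conj_simple i (up j w).
  apply: up_conj; rewrite u2 /fixes_pair !permnM !permn_simple ji ?swapE.
  apply/negP; rewrite /swap_nat; move: ascj nf e1 e2; split_eqs; lia.
have w1 : up i (up j (up i w)) = conj_simple i (up j (up i w)).
  apply: up_conj; rewrite v1 u1 /fixes_pair !permnM !permn_simple ji ?swapE.
  apply/negP; rewrite /swap_nat; move: ascj nf e1 e2; split_eqs; lia.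
have w2 : up j (up i (up j w)) = (up i (up j w) * simple j)%g.
  apply: up_mul; rewrite v2 u2 /fixes_pair !permnM !permn_simple ji ?swapE.
  rewrite /swap_nat; move: ascj nf e1 e2; split_eqs; lia.
rewrite w1 w2 v1 v2 u1 u2 /conj_simple.
rewrite !permnM !permn_simple ji ?swapE; split.
- by rewrite /swap_nat; move: ascj nf e1 e2; split_eqs; lia.
- by rewrite /swap_nat; move: ascj nf e1 e2; split_eqs; lia.
- by rewrite /swap_nat; move: ascj nf e1 e2; split_eqs; lia.
- by rewrite /swap_nat; move: ascj nf e1 e2; split_eqs; lia.
have := simple_braid ji; rewrite -!mulgA => ->; by [].
Qed.

Lemma hexagon_fixed_right w i j : j = i.+1 :> nat -> ascent i w ->
  fixes_pair j w -> permn w i != i ->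
  [/\ ascent j (up i w), ascent i (up j (up i w)),
      ascent i (up j w), ascent j (up i (up j w))
    & up i (up j (up i w)) = up j (up i (up j w))].
Proof.
move=> ji; rewrite /ascent ji => asci fj nf; have := fj.
rewrite {1}/fixes_pair ji => /andP[/eqP e1 /eqP e2].
have fi : fixes_pair i w = false by rewrite /fixes_pair (negbTE nf).
have u1 : up i w = conj_simple i w by rewrite /up fi.
have u2 : up j w = (w * simple j)%g by rewrite /up fj.
have v1 : up j (up i w) = conj_simple j (up i w).
  apply: up_conj; rewrite u1 /fixes_pair ji !permnM !permn_simple ?ji ?swapE.
  apply/negP; rewrite /swap_nat; move: asci nf e1 e2; split_eqs; lia.
have v2 : up i (up j w) = conj_simple i (up j w).
  apply: up_conj; rewrite u2 /fixes_pair !permnM !permn_simple ji ?swapE.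
  apply/negP; rewrite /swap_nat; move: asci nf e1 e2; split_eqs; lia.
have w1 : up i (up j (up i w)) = (up j (up i w) * simple i)%g.
  apply: up_mul; rewrite v1 u1 /fixes_pair !permnM !permn_simple ji ?swapE.
  rewrite /swap_nat; move: asci nf e1 e2; split_eqs; lia.
have w2 : up j (up i (up j w)) = conj_simple j (up i (up j w)).
  apply: up_conj; rewrite v2 u2 /fixes_pair !permnM !permn_simple ji ?swapE.
  apply/negP; rewrite /swap_nat; move: asci nf e1 e2; split_eqs; lia.
rewrite w1 w2 v1 v2 u1 u2 /conj_simple.
rewrite !permnM !permn_simple ji ?swapE; split.
- by rewrite /swap_nat; move: asci nf e1 e2; split_eqs; lia.
- by rewrite /swap_nat; move: asci nf e1 e2; split_eqs; lia.
- by rewrite /swap_nat; move: asci nf e1 e2; split_eqs; lia.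
- by rewrite /swap_nat; move: asci nf e1 e2; split_eqs; lia.
have := simple_braid ji; rewrite -!mulgA => ->; by [].
Qed.

Lemma hexagon_free w i j : w \in invol n -> j = i.+1 :> nat ->
  ascent i w -> ascent j w -> ~~ fixes_pair i w -> ~~ fixes_pair j w ->
  [/\ ascent j (up i w), ascent i (up j (up i w)),
      ascent i (up j w), ascent j (up i (up j w))
    & up i (up j (up i w)) = up j (up i (up j w))].
Proof.
move=> /permn_invol wK ji; rewrite /ascent ji => asci ascj fi fj.
have := fi; have := fj; rewrite {1 2}/fixes_pair ji => nf2 nf1.
have u1 : up i w = conj_simple i w by rewrite /up (negbTE fi).
have u2 : up j w = conj_simple j w by rewrite /up (negbTE fj).
have sym a b : permn w a = b -> permn w b = a by move=> <-; rewrite wK.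
have := sym i.+1 i; have := sym i.+1 i.+2 => k2 k1.
have v1 : up j (up i w) = conj_simple j (up i w).
  apply: up_conj; rewrite u1 /fixes_pair ji !permnM !permn_simple ?ji ?swapE.
  apply/negP; rewrite /swap_nat; move: asci ascj nf1 nf2; split_eqs; lia.
have v2 : up i (up j w) = conj_simple i (up j w).
  apply: up_conj; rewrite u2 /fixes_pair !permnM !permn_simple ji ?swapE.
  apply/negP; rewrite /swap_nat; move: asci ascj nf1 nf2; split_eqs; lia.
have w1 : up i (up j (up i w)) = conj_simple i (up j (up i w)).
  apply: up_conj; rewrite v1 u1 /fixes_pair !permnM !permn_simple ji ?swapE.
  apply/negP; rewrite /swap_nat; move: asci ascj nf1 nf2; split_eqs; lia.
have w2 : up j (up i (up j w)) = conj_simple j (up i (up j w)).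
  apply: up_conj; rewrite v2 u2 /fixes_pair !permnM !permn_simple ji ?swapE.
  apply/negP; rewrite /swap_nat; move: asci ascj nf1 nf2; split_eqs; lia.
rewrite w1 w2 v1 v2 u1 u2 /conj_simple.
rewrite !permnM !permn_simple ji ?swapE; split.
- by rewrite /swap_nat; move: asci ascj nf1 nf2 k1 k2; split_eqs; lia.
- by rewrite /swap_nat; move: asci ascj nf1 nf2 k1 k2; split_eqs; lia.
- by rewrite /swap_nat; move: asci ascj nf1 nf2 k1 k2; split_eqs; lia.
- by rewrite /swap_nat; move: asci ascj nf1 nf2 k1 k2; split_eqs; lia.
have braid x : (simple i * (simple j * (simple i * x)) =
    simple j * (simple i * (simple j * x)))%g.
  by rewrite !mulgA (simple_braid ji).
have := simple_braid ji; rewrite -!mulgA => e; rewrite e; exact: braid.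
Qed.

End LocalRelations.

(** * Involutions with few ascents *)

Section BottomOfWeakOrder.
Variable n : nat.
Implicit Types (i j k : 'I_n.-1) (u w : 'S_n).

Lemma permn_sym w a b : w \in invol n -> permn w a = b -> permn w b = a.
Proof. by move/permn_invol => wK <-. Qed.

Lemma longest_no_ascent i : ascent i (longest n) = false.
Proof.
have := ltn_ord i; rewrite /ascent => ?.
by rewrite !permn_longest; lia.
Qed.

(** Apart from i and j every position is a descent of w, and conjugating by s_i
    makes these two positions descents as well, without creating an ascent
    next to them; a permutation without ascents is w_0. *)
Lemma up_exchange_longest w i j : w \in invol n -> apart i j ->
  exchanges w i j -> (forall k, ascent k w -> k = i \/ k = j) ->
  up i w = longest n /\ (i + j).+2 = n.
Proof.
move=> wI ij /andP[/eqP e1 /eqP e2] only.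
have e3 := permn_sym wI e1; have e4 := permn_sym wI e2.
have fi : fixes_pair i w = false.
  by apply/negP => /andP[/eqP f1 _]; move: ij; rewrite /apart; lia.
have top : up i w = longest n.
  apply: no_ascent => k; rewrite /ascent -leqNgt !permn_up fi.
  case: (eqVneq (k : nat) i) => [->|ki].
    by rewrite !swapE e1 e2 /swap_nat; move: ij; rewrite /apart; split_eqs; lia.
  case: (eqVneq (k : nat) j) => [->|kj].
    by rewrite (@swap_natD i j) 1?(@swap_natD i j.+1) ?e3 ?e4 ?swapE;
      move: ij; rewrite /apart; lia.
  have desc : (permn w k.+1 < permn w k)%N.
    by apply: ascentN; apply/negP => /only[] e; rewrite e eqxx in ki kj.
  move: ij; rewrite /apart => ij.
  case: (eqVneq (k.+1 : nat) i) => [k1|k1i].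
    have wk : permn w k <> j.+1 by move/(permn_sym wI); lia.
    rewrite k1 in desc *; rewrite swapE e2 (@swap_natD i k); try lia.
    by rewrite /swap_nat; split_eqs; lia.
  case: (eqVneq (k : nat) i.+1) => [k1|ki1].
    have wk : permn w k.+1 <> j by move/(permn_sym wI); lia.
    rewrite k1 in kj desc wk *; rewrite !swapE e1.
    by rewrite /swap_nat; split_eqs; lia.
  have wk : permn w k <> i by move/(permn_sym wI); lia.
  have wk1 : permn w k.+1 <> i.+1 by move/(permn_sym wI); lia.
  have wk2 : ~ (permn w k = i.+1 /\ permn w k.+1 = i).
    by move=> [/(permn_sym wI) ? /(permn_sym wI)]; lia.
  rewrite !(@swap_natD i k) // !(@swap_natD i k.+1) //.
  by rewrite /swap_nat; split_eqs; lia.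
split=> //; have := @permn_longest n i; rewrite -top permn_up fi swapE e2.
have := ltn_ord i; have := ltn_ord j; move: ij; rewrite /apart /swap_nat.
by split_eqs; lia.
Qed.

(** All descents of w outside the fixed block survive in u, including those at
    its two borders, since w maps the outside of the block to itself; and u
    descends inside the block. *)
Lemma reversed_block_longest w u p m : w \in invol n -> (p + m < n)%N ->
  (forall x, (p <= x <= p + m)%N -> permn w x = x) ->
  (forall x, (p <= x <= p + m)%N -> permn u x = p + p + m - x)%N ->
  (forall x, ~~ (p <= x <= p + m)%N -> permn u x = permn w x) ->
  (forall k, ascent k w -> (p <= k < p + m)%N) ->
  u = longest n /\ (p + p + m).+1 = n.
Proof.
move=> wI pm fixw revu outu only.
have outw x : ~~ (p <= x <= p + m)%N -> ~~ (p <= permn w x <= p + m)%N.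
  by apply: contra => b; have /permn_inj e := fixw _ b; rewrite e in b.
have top : u = longest n.
  apply: no_ascent => k; rewrite /ascent -leqNgt.
  have desc : ~~ (p <= k < p + m)%N -> (permn w k.+1 < permn w k)%N.
    by move=> nk; apply: ascentN; apply/negP => /only; apply/negP.
  case: (boolP (p <= k <= p + m)%N) => k1; case: (boolP (p <= k.+1 <= p + m)%N) => k2.
  - by rewrite !revu //; lia.
  - have := outw _ k2; rewrite (revu _ k1) (outu _ k2).
    by have := desc _; rewrite (fixw _ k1); lia.
  - have := outw _ k1; rewrite (revu _ k2) (outu _ k1).
    by have := desc _; rewrite (fixw _ k2); lia.
  - by rewrite !outu //; apply/ltnW/desc; lia.
split=> //; have := @permn_longest n p; rewrite -top revu; lia.
Qed.

End BottomOfWeakOrder.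

Section MiddleBlocks.
Variable n : nat.
Implicit Types (i j k : 'I_n.-1) (u w : 'S_n).

Lemma up_outside_block w u i p m : (p <= i < p + m)%N ->
  (forall x, (p <= x <= p + m)%N -> permn w x = x) ->
  (forall x, ~~ (p <= x <= p + m)%N -> permn u x = permn w x) ->
  forall x, ~~ (p <= x <= p + m)%N -> permn (up i u) x = permn w x.
Proof.
move=> pi fixw outu x xout.
have wout : ~~ (p <= permn w x <= p + m)%N.
  by apply: contra xout => b; have /permn_inj e := fixw _ b; rewrite e in b.
rewrite permn_up (_ : (if _ then _ else _) = x); last first.
  by case: ifP => // _; rewrite swap_natD //; lia.
by rewrite outu // swap_natD //; lia.
Qed.

(** Both climbs reverse the fixed block, which leaves no ascent. *)
Lemma climb_middle_three w i j : w \in invol n -> j = i.+1 :> nat ->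
  (forall x, (i <= x <= i + 2)%N -> permn w x = x) ->
  (forall k, ascent k w -> (i <= k < i + 2)%N) ->
  [/\ climb (up i w) [:: j], climb (up j w) [:: i] & (i + i + 2).+1 = n].
Proof.
move=> wI ji fixw only; have jlt := ltn_ord j.
have w0 := fixw i; have w1 := fixw i.+1; have w2 := fixw i.+2.
have {}w0 : permn w i = i by apply: w0; lia.
have {}w1 : permn w i.+1 = i.+1 by apply: w1; lia.
have {}w2 : permn w i.+2 = i.+2 by apply: w2; lia.
have out1 := @up_outside_block w _ i i 2 _ fixw.
have out2 := @up_outside_block w _ j i 2 _ fixw.
have fi : fixes_pair i w by rewrite /fixes_pair w0 w1 !eqxx.
have fj : fixes_pair j w by rewrite /fixes_pair ji w1 w2 !eqxx.
have nfj : fixes_pair j (up i w) = false.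
  by apply/negP; rewrite /fixes_pair !permn_up fi ji w1 ?swapE; lia.
have nfi : fixes_pair i (up j w) = false.
  by apply/negP; rewrite /fixes_pair !permn_up fj ji w0 w1 ?swapE; lia.
have three x : (i <= x <= i + 2)%N -> x = i \/ x = i.+1 \/ x = i.+2.
  by lia.
have [|||topi ni] := @reversed_block_longest n w (up j (up i w)) i 2 wI _ fixw _ _ only.
- lia.
- move=> x /three[|[|]] ->; rewrite permn_up nfj ji permn_up fi ?swapE ?w0 ?w1 ?w2 ?swapE; lia.
- by apply: out2; [lia | apply: out1 => //; lia].
have [|||topj _] := @reversed_block_longest n w (up i (up j w)) i 2 wI _ fixw _ _ only.
- lia.
- move=> x /three[|[|]] ->; rewrite permn_up nfi permn_up fj ji ?swapE ?w0 ?w1 ?w2 ?swapE; lia.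
- by apply: out1; [lia | apply: out2 => //; lia].
rewrite /= topi topj !eqxx !andbT; split=> //.
- by rewrite /ascent !permn_up fi ji w1 w2 ?swapE.
- by rewrite /ascent !permn_up fj ji w0 w1 ?swapE.
Qed.

(** The two climbs meet after two steps: both [:: i; j] and [:: j; i] lead to w
    followed by the exchange of i and i + 2. *)
Lemma climb_middle_four w i j k : w \in invol n ->
  j = i.+1 :> nat -> k = i.+2 :> nat ->
  (forall x, (i <= x <= i + 3)%N -> permn w x = x) ->
  (forall l, ascent l w -> (i <= l < i + 3)%N) ->
  [/\ climb (up i w) [:: j; k; j], climb (up j w) [:: i; k; j]
    & (i + i + 3).+1 = n].
Proof.
move=> wI ji ki fixw only; have klt := ltn_ord k.
have w0 : permn w i = i by apply: fixw; lia.
have w1 : permn w i.+1 = i.+1 by apply: fixw; lia.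
have w2 : permn w i.+2 = i.+2 by apply: fixw; lia.
have w3 : permn w i.+3 = i.+3 by apply: fixw; lia.
have far1 : swap_nat i i.+3 = i.+3 by rewrite swap_natD //; lia.
have far2 : swap_nat i.+2 i = i by rewrite swap_natD //; lia.
have fi : fixes_pair i w by rewrite /fixes_pair w0 w1 !eqxx.
have fj : fixes_pair j w by rewrite /fixes_pair ji w1 w2 !eqxx.
have nfj : fixes_pair j (up i w) = false.
  by apply/negP; rewrite /fixes_pair !permn_up fi ji w1 ?swapE; lia.
have nfi : fixes_pair i (up j w) = false.
  by apply/negP; rewrite /fixes_pair !permn_up fj ji w0 w1 ?swapE; lia.
have four x : (i <= x <= i + 3)%N ->
    x = i \/ x = i.+1 \/ x = i.+2 \/ x = i.+3 by lia.
pose u := up j (up i w).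
have u0 : permn u i = i.+2.
  by rewrite permn_up nfj ji permn_up fi ?swapE w0 ?swapE.
have u1 : permn u i.+1 = i.+1.
  by rewrite permn_up nfj ji permn_up fi ?swapE w2 ?swapE.
have u2 : permn u i.+2 = i.
  by rewrite permn_up nfj ji permn_up fi ?swapE w1 ?swapE.
have u3 : permn u i.+3 = i.+3.
  by rewrite permn_up nfj ji permn_up fi ?swapE w3 far1 ?swapE.
have outu : forall x, ~~ (i <= x <= i + 3)%N -> permn u x = permn w x.
  apply: up_outside_block => //; first by lia.
  by apply: up_outside_block => //; lia.
have same : up i (up j w) = u.
  apply: eq_permn => x _; case: (boolP (i <= x <= i + 3)%N) => [/four|out].
    case=> [|[|[|]]] ->; rewrite ?u0 ?u1 ?u2 ?u3 permn_up nfi permn_up fj ji;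
      by rewrite ?swapE ?far1 ?swapE ?w0 ?w1 ?w2 ?w3 ?swapE ?far1 ?swapE.
  rewrite outu //; apply: (@up_outside_block w _ i i 3) => //; first by lia.
  by apply: up_outside_block => //; lia.
have nfu : fixes_pair k u = false.
  by apply/negP; rewrite /fixes_pair ki u2; lia.
pose v := up k u.
have v0 : permn v i = i.+3 by rewrite permn_up nfu ki far2 u0 ?swapE.
have v1 : permn v i.+1 = i.+1 by rewrite permn_up nfu ki ?swapE u1 ?swapE.
have v2 : permn v i.+2 = i.+2 by rewrite permn_up nfu ki ?swapE u3 ?swapE.
have v3 : permn v i.+3 = i by rewrite permn_up nfu ki ?swapE u2 far2.
have fv : fixes_pair j v by rewrite /fixes_pair ji v1 v2 !eqxx.
have [|||top ->] :=
  @reversed_block_longest n w (up j v) i 3 wI _ fixw _ _ only.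
- lia.
- move=> x /four[|[|[|]]] ->; rewrite permn_up fv ji ?v0 ?v1 ?v2 ?v3;
    rewrite ?swapE; rewrite ?swap_natD; lia.
- apply: up_outside_block => //; first by lia.
  by apply: up_outside_block => //; lia.
rewrite /= same -/u -/v top eqxx !andbT; split=> //; apply/and3P; split.
- by rewrite /ascent !permn_up fi ji w1 w2 ?swapE.
- by rewrite /ascent ki u2 u3; lia.
- by rewrite /ascent ji v1 v2.
- by rewrite /ascent !permn_up fj ji w0 w1 ?swapE.
- by rewrite /ascent ki u2 u3; lia.
- by rewrite /ascent ji v1 v2.
Qed.

End MiddleBlocks.

(** * Path independence *)

Section PathIndependence.
Variables (n : nat) (P : {mpoly rat[n]}).
Implicit Types (i j k : 'I_n.-1) (w : 'S_n) (t : seq 'I_n.-1).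

Definition word_dd t (f : {mpoly rat[n]}) : {mpoly rat[n]} :=
  foldr (@divided_difference n) f t.

(* These hypotheses are the comparisons of paths that no third ascent
   resolves. *)
Hypothesis P_exchange : forall i j, (i.+1 < j)%N -> (i + j).+2 = n ->
  divided_difference i P = divided_difference j P.
Hypothesis P_three : forall i j, j = i.+1 :> nat -> (i + i + 2).+1 = n ->
  word_dd [:: i; j] P = word_dd [:: j; i] P.
Hypothesis P_four : forall i j k, j = i.+1 :> nat -> k = i.+2 :> nat ->
  (i + i + 3).+1 = n -> word_dd [:: i; j; k; j] P = word_dd [:: j; i; k; j] P.

Definition path_independent w :=
  forall t u, climb w t -> climb w u -> word_dd t P = word_dd u P.

(** The two edges at w labelled i and j give the same value; this is an
    equivalence relation on the ascents of w, shown to be total by linking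
    ascents through each other. *)
Definition same_value w i j := forall t u,
  climb (up i w) t -> climb (up j w) u ->
  word_dd (i :: t) P = word_dd (j :: u) P.

Section Step.
Variable w : 'S_n.
Hypothesis wI : w \in invol n.
Hypothesis IH : forall i, ascent i w -> path_independent (up i w).

Lemma same_valueC i j : same_value w i j -> same_value w j i.
Proof. by move=> e t u ct cu; symmetry; apply: e. Qed.

Lemma same_value_trans i k j : ascent k w ->
  same_value w i k -> same_value w k j -> same_value w i j.
Proof.
move=> /(up_invol wI)/climb_exists[v cv] e1 e2 t u ct cu.
exact (etrans (e1 t v ct cv) (e2 v u cv cu)).
Qed.

Lemma same_value_words i j t u : ascent i w -> ascent j w ->
  climb (up i w) t -> climb (up j w) u ->
  word_dd (i :: t) P = word_dd (j :: u) P -> same_value w i j.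
Proof.
move=> ai aj ct cu e t' u' ct' cu'; apply: etrans (etrans _ e) _.
  exact: congr1 (IH ai ct' ct).
exact: congr1 (IH aj cu cu').
Qed.

Lemma same_value_diamond i j : apart i j -> ascent i w -> ascent j w ->
  ~~ exchanges w i j -> same_value w i j.
Proof.
move=> ij ai aj nex; have [a1 a2 e] := diamond wI ij ai aj nex.
have [v cv] := climb_exists (up_invol (up_invol wI ai) a1).
apply: (@same_value_words i j (j :: v) (i :: v) ai aj).
- by rewrite /= a1.
- by rewrite /= a2 -e.
- exact: divided_difference_commute.
Qed.

Lemma same_value_hexagon i j : j = i.+1 :> nat -> ascent i w -> ascent j w ->
  ~~ (fixes_pair i w && fixes_pair j w) -> same_value w i j.
Proof.
move=> ji ai aj nf.
have [a1 a2 b1 b2 e] : [/\ ascent j (up i w), ascent i (up j (up i w)),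
    ascent i (up j w), ascent j (up i (up j w))
  & up i (up j (up i w)) = up j (up i (up j w))].
  case: (boolP (fixes_pair i w)) (boolP (fixes_pair j w)) nf => [fi|fi] [fj|fj] // nf.
  - apply: hexagon_fixed_left => //; move: fi fj; rewrite /fixes_pair ji; lia.
  - apply: hexagon_fixed_right => //; move: fi fj; rewrite /fixes_pair ji; lia.
  - exact: hexagon_free.
have uI := up_invol (up_invol (up_invol wI ai) a1) a2.
have [v cv] := climb_exists uI.
apply: (@same_value_words i j (j :: i :: v) (i :: j :: v) ai aj).
- by rewrite /= a1 a2.
- by rewrite /= b1 b2 -e.
- exact: divided_difference_braid.
Qed.

(** An ascent that w moves, and does not exchange with k, is in no degenerate
    configuration with k. *)
Lemma same_value_moved i k : ascent i w -> ascent k w ->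
  permn w i != i -> permn w i != k -> permn w i.+1 != i.+1 ->
  same_value w i k.
Proof.
move=> ai ak wi wik wi1.
have [ap|] := boolP (apart i k).
  by apply: (same_value_diamond ap ai ak); rewrite /exchanges (negbTE wik).
rewrite /apart => nap.
have [/val_inj <-|ik] := eqVneq (i : nat) k.
  by move=> t u ct cu; apply: congr1 (IH ai ct cu).
have [ki|ki] := eqVneq (k : nat) i.+1.
  by apply: (same_value_hexagon ki ai ak); rewrite /fixes_pair (negbTE wi).
apply/same_valueC/(same_value_hexagon _ ak ai); first by lia.
by rewrite /fixes_pair (negbTE wi) andbF.
Qed.

(** If i and j are exchanged, any third ascent k is in general position with
    both; without a third ascent, the two edges end at w_0. *)
Lemma same_value_apart i j : apart i j -> ascent i w -> ascent j w ->
  same_value w i j.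
Proof.
move=> ij ai aj; have [ex|] := boolP (exchanges w i j); last first.
  exact: same_value_diamond.
have ex' : exchanges w j i by rewrite -exchangesC.
have [/eqP e1 /eqP e2] := andP ex; have [/eqP e3 /eqP e4] := andP ex'.
have := ij; rewrite /apart => ij'.
have [/existsP[k /and3P[ak ki kj]]|none] :=
  boolP [exists k, [&& ascent k w, k != i :> nat & k != j :> nat]].
  apply: (same_value_trans ak).
    by apply: (same_value_moved ai ak); rewrite ?e1 ?e2; lia.
  by apply/same_valueC/(same_value_moved aj ak); rewrite ?e3 ?e4; lia.
have only k : ascent k w -> k = i \/ k = j.
  move=> ak; have := existsPn none k; rewrite ak /= negb_and !negbK.
  by case/orP => /eqP/val_inj; auto.
have [topi nij] := up_exchange_longest wI ij ex only.
have only' k : ascent k w -> k = j \/ k = i by move/only => []; auto.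
have [|topj _] := up_exchange_longest wI _ ex' only'; first by rewrite /apart orbC.
apply: (@same_value_words i j [::] [::] ai aj).
- by rewrite /= topi.
- by rewrite /= topj.
case/orP: ij => ij; first exact: P_exchange ij nij.
by symmetry; apply: P_exchange ij _; rewrite addnC.
Qed.

(** The hard case is a run of fixed points i, i + 1, i + 2.  An ascent apart from
    both i and j links them; the other ascents can only be i - 1 and i + 2.
    Either of these links i to j unless it prolongs the run.  A run of five
    points links i to i + 2, to i - 1, to i + 1; runs of four and three points
    are the exceptional middle blocks. *)
Lemma same_value_adjacent i j : j = i.+1 :> nat -> ascent i w -> ascent j w ->
  same_value w i j.
Proof.
move=> ji ai aj; have [fij|] := boolP (fixes_pair i w && fixes_pair j w); last first.
  exact: same_value_hexagon.
have [w0 w1 w2] : [/\ permn w i = i, permn w i.+1 = i.+1 & permn w i.+2 = i.+2].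
  by move: fij; rewrite /fixes_pair ji; split; lia.
have [/existsP[k /and3P[ak ki kj]]|none] :=
  boolP [exists k, [&& ascent k w, apart i k & apart k j]].
  by apply: (same_value_trans ak); apply: same_value_apart.
have near k : ascent k w -> (i <= k.+1 <= i + 3)%N.
  move=> ak; have := existsPn none k; rewrite ak /apart ji /=; lia.
have apart_rel (k l : 'I_n.-1) : (k.+1 < l)%N ->
    ascent k w -> ascent l w -> same_value w k l.
  by move=> kl; apply: same_value_apart; rewrite /apart ?kl.
have [/existsP[k /andP[ak /eqP ki]]|nok] :=
  boolP [exists k, ascent k w && (k.+1 == i)].
  have kj : same_value w k j by apply: (apart_rel _ _ _ ak aj); lia.
  have [wk|wk] := eqVneq (permn w k) k; last first.
    apply: (same_value_trans ak _ kj); apply: same_valueC.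
    by apply: (same_value_hexagon _ ak ai); rewrite /fixes_pair ?(negbTE wk).
  have [/existsP[l /andP[al /eqP li]]|nol] :=
    boolP [exists l, ascent l w && (l == i.+2 :> nat)].
    have il : same_value w i l by apply: (apart_rel _ _ _ ai al); lia.
    apply: (same_value_trans al il); apply: (same_value_trans ak _ kj).
    by apply/same_valueC/(apart_rel _ _ _ ak al); lia.
  have [||||c1 c2 e] := @climb_middle_four n w k i j wI.
  - by [].
  - by rewrite ji -ki.
  - move=> x b; have : x = k \/ x = i \/ x = i.+1 \/ x = i.+2 by lia.
      by case=> [|[|[|]]] ->.
  - move=> l al; have := existsPn nol l; rewrite al /= => li.
    by have := near _ al; lia.
  apply: (same_value_trans ak _ kj); apply/same_valueC.
  by apply: (same_value_words ak ai c1 c2); apply: P_four e; rewrite ?ji -ki.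
have [/existsP[l /andP[al /eqP li]]|nol] :=
  boolP [exists l, ascent l w && (l == i.+2 :> nat)].
  have [wl|wl] := eqVneq (permn w i.+3) i.+3; last first.
    apply: (same_value_trans al); first by apply: (apart_rel _ _ _ ai al); lia.
    apply/same_valueC/(same_value_hexagon _ aj al); first by lia.
    by rewrite /fixes_pair li (negbTE wl) !andbF.
  have [||||c1 c2 e] := @climb_middle_four n w i j l wI.
  - by [].
  - by [].
  - move=> x b; have : x = i \/ x = i.+1 \/ x = i.+2 \/ x = i.+3 by lia.
      by case=> [|[|[|]]] ->.
  - move=> k ak; have := existsPn nok k; rewrite ak /= => ki.
    by have := near _ ak; lia.
  by apply: (same_value_words ai aj c1 c2); apply: P_four e.
have [||c1 c2 e] := @climb_middle_three n w i j wI ji.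
- move=> x b; have : x = i \/ x = i.+1 \/ x = i.+2 by lia. by case=> [|[|]] ->.
- move=> k ak; have := existsPn nok k; have := existsPn nol k.
  by rewrite ak /= => k1 k2; have := near _ ak; lia.
by apply: (same_value_words ai aj c1 c2); apply: P_three ji e.
Qed.

Lemma same_value_ascents i j : ascent i w -> ascent j w -> same_value w i j.
Proof.
move=> ai aj; have [/val_inj <-|ij] := eqVneq (i : nat) j.
  by move=> t u ct cu; apply: congr1 (IH ai ct cu).
have [ap|nap] := boolP (apart i j); first exact: same_value_apart.
have [ji|ji] := eqVneq (j : nat) i.+1; first exact: same_value_adjacent.
by apply/same_valueC/(same_value_adjacent _ aj ai); move: nap; rewrite /apart; lia.
Qed.

End Step.

Lemma climb_path_independent w : w \in invol n -> path_independent w.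
Proof.
move: {2}(_ - _)%N (leqnn (n * n - coxeter_length w)) => d.
elim: d w => [|d IH] w wd wI.
  have noasc i : ascent i w = false.
    apply/negP => ai; have := up_length wI ai.
    by have := coxeter_length_bound (up i w); lia.
  case=> [|i t] [|j u]; first by move=> _ _; reflexivity.
  - by move=> _ /andP[a _]; exfalso; rewrite noasc in a.
  - by move=> /andP[a _] _; exfalso; rewrite noasc in a.
  - by move=> /andP[a _] _; exfalso; rewrite noasc in a.
have IHw i : ascent i w -> path_independent (up i w).
  move=> ai; apply: IH (up_invol wI ai); have := up_length wI ai.
  by have := coxeter_length_bound (up i w); lia.
case=> [|i t] [|j u]; first by move=> _ _; reflexivity.
- by move=> /eqP -> /andP[]; rewrite longest_no_ascent.
- by move=> /andP[ai _] /eqP wl; rewrite wl longest_no_ascent in ai.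
- by move=> /andP[ai ct] /andP[aj cu]; apply: (same_value_ascents wI IHw ai aj).
Qed.

End PathIndependence.

Section Staircase.
Implicit Types (r : rel nat) (d : bool).

Definition del (p q : nat) r : rel nat := fun a b =>
  r a b && ~~ ((a == p) && (b == q) || (a == q) && (b == p)).

(** The flag d tells whether the diagonal is included: true for the orthogonal
    and false for the symplectic case.  Indices start at 0, whence the 2. *)
Definition staircase d (n : nat) : rel nat := fun a b =>
  (d || (a != b)) && (a + b + 2 <= n)%N.

Lemma divided_difference_del n (i : 'I_n.-1) (q : nat) r : (q < n)%N ->
  q != i.+1 -> r i q -> r q i -> stable_under n i (del i q r) ->
  divided_difference i (pair_product n r) = pair_product n (del i q r).
Proof.
move=> qn qi riq rqi st; apply: (divided_difference_pair_product qn qi _ _ st).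
- by rewrite /del !eqxx andbF.
- by rewrite /del !eqxx orbT andbF.
move=> a b _ _; rewrite /del -orbA.
have : (a == i) && (b == q) || (a == q) && (b == i) -> r a b.
  by case/orP=> /andP[/eqP -> /eqP ->].
by case: (r a b); case: (_ || _) => // /(_ isT).
Qed.

Variables (d : bool) (n : nat).
Let P : {mpoly rat[n]} := pair_product n (staircase d n).

(** Both d_i and d_j erase the pair {i, j}. *)
Lemma staircase_exchange (i j : 'I_n.-1) : (i.+1 < j)%N -> (i + j).+2 = n ->
  divided_difference i P = divided_difference j P.
Proof.
move=> ij nij; have := ltn_ord j => jn.
apply: etrans (@divided_difference_del n i j (staircase d n) _ _ _ _ _) _;
  rewrite /staircase; try lia.
  move=> a b _ _; rewrite /del /swap_nat; split_eqs; lia.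
symmetry.
apply: etrans (@divided_difference_del n j i (staircase d n) _ _ _ _ _) _;
  rewrite /staircase; try lia.
  move=> a b _ _; rewrite /del /swap_nat; split_eqs; lia.
by apply: eq_pair_product => a b _ _; rewrite /del; lia.
Qed.

(** On the staircase with its diagonal, d_j erases the pair {i, j} and d_i the
    pair {i, i}, in either order. *)
Lemma staircase_three (i j : 'I_n.-1) : d || ~~ odd n ->
  j = i.+1 :> nat -> (i + i + 2).+1 = n ->
  word_dd [:: i; j] P = word_dd [:: j; i] P.
Proof.
move=> dn ji ni; have jn := ltn_ord j; have dT : d by lia.
have e1 : divided_difference j P = pair_product n (del j i (staircase d n)).
  apply: divided_difference_del; rewrite /staircase ?ji ?dT; try lia.
  move=> a b _ _; rewrite /del /swap_nat; split_eqs; lia.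
have e2 : divided_difference i P = pair_product n (del i i (staircase d n)).
  apply: divided_difference_del; rewrite /staircase ?dT; try lia.
  move=> a b _ _; rewrite /del /swap_nat; split_eqs; lia.
have e3 : divided_difference i (pair_product n (del j i (staircase d n))) =
    pair_product n (del i i (del j i (staircase d n))).
  apply: divided_difference_del; rewrite /del /staircase ?ji ?dT; try lia.
  move=> a b _ _; rewrite /swap_nat; split_eqs; lia.
have e4 : divided_difference j (pair_product n (del i i (staircase d n))) =
    pair_product n (del j i (del i i (staircase d n))).
  apply: divided_difference_del; rewrite /del /staircase ?ji ?dT; try lia.
  move=> a b _ _; rewrite /swap_nat; split_eqs; lia.
rewrite /word_dd /= e1 e2 e3 e4.
by apply: eq_pair_product => a b _ _; rewrite /del; lia.
Qed.

(** With the diagonal, d_j and then d_k erase {j, j} and {i, k}; what remains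
    loses {i, j} to d_j and {i, i} to d_i, in either order.  Without the
    diagonal the staircase is stable under s_j and both sides vanish. *)
Lemma staircase_four (i j k : 'I_n.-1) :
  j = i.+1 :> nat -> k = i.+2 :> nat -> (i + i + 3).+1 = n ->
  word_dd [:: i; j; k; j] P = word_dd [:: j; i; k; j] P.
Proof.
move=> ji ki ni; have kn := ltn_ord k.
have [dT|dF] := boolP d; last first.
  have e : divided_difference j P = 0.
    apply/divided_difference_sym/msym_pair_product => a b _ _.
    by rewrite /staircase /swap_nat ji (negbTE dF); split_eqs; lia.
  have dd0 (l : 'I_n.-1) : divided_difference l (0 : {mpoly rat[n]}) = 0.
    by apply: divided_difference_sym; apply: msym0.
  by rewrite /word_dd /= e !dd0.
pose r1 := del j j (staircase d n); pose r2 := del k i r1.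
have e1 : divided_difference j P = pair_product n r1.
  apply: divided_difference_del; rewrite /staircase ?ji ?dT; try lia.
  move=> a b _ _; rewrite /del /swap_nat; split_eqs; lia.
have e2 : divided_difference k (pair_product n r1) = pair_product n r2.
  apply: divided_difference_del; rewrite /r1 /del /staircase ?ji ?ki ?dT; try lia.
  move=> a b _ _; rewrite /swap_nat; split_eqs; lia.
have e3 : divided_difference j (pair_product n r2) =
    pair_product n (del j i r2).
  apply: divided_difference_del; rewrite /r2 /r1 /del /staircase ?ji ?ki ?dT; try lia.
  move=> a b _ _; rewrite /swap_nat; split_eqs; lia.
have e4 : divided_difference i (pair_product n r2) =
    pair_product n (del i i r2).
  apply: divided_difference_del; rewrite /r2 /r1 /del /staircase ?ji ?ki ?dT; try lia.
  move=> a b _ _; rewrite /swap_nat; split_eqs; lia.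
have e5 : divided_difference i (pair_product n (del j i r2)) =
    pair_product n (del i i (del j i r2)).
  apply: divided_difference_del; rewrite /r2 /r1 /del /staircase ?ji ?ki ?dT; try lia.
  move=> a b _ _; rewrite /swap_nat; split_eqs; lia.
have e6 : divided_difference j (pair_product n (del i i r2)) =
    pair_product n (del j i (del i i r2)).
  apply: divided_difference_del; rewrite /r2 /r1 /del /staircase ?ji ?ki ?dT; try lia.
  move=> a b _ _; rewrite /swap_nat; split_eqs; lia.
rewrite /word_dd /= e1 e2 e3 e4 e5 e6.
by apply: eq_pair_product => a b _ _; rewrite /del; lia.
Qed.

Lemma staircase_path_independent w : d || ~~ odd n -> w \in invol n ->
  path_independent P w.
Proof.
move=> dn; apply: climb_path_independent.
- exact: staircase_exchange.
- by move=> i j; apply: staircase_three.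
- exact: staircase_four.
Qed.

End Staircase.

(** * Adding points *)

Section Substitution.
Variables n N M : nat.
Implicit Type f : {mpoly rat[n]}.

(** Substitution is determined by the images of the variables; this covers both
    permuting variables and iterating embeddings. *)
Lemma lrmorph_comp_mpoly (phi : {lrmorphism {mpoly rat[N]} -> {mpoly rat[M]}})
    f (T : n.-tuple {mpoly rat[N]}) (U : n.-tuple {mpoly rat[M]}) :
  (forall a, phi (tnth T a) = tnth U a) -> phi (f \mPo T) = f \mPo U.
Proof.
move=> TU; rewrite !comp_mpolyE linear_sum; apply: eq_bigr => m _.
rewrite linearZ rmorph_prod; congr (_ *: _); apply: eq_bigr => a _.
by rewrite rmorphXn; congr (_ ^+ _); apply: TU.
Qed.

End Substitution.

Section Widening.
Variables (n N : nat) (le_nN : (n <= N)%N).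
Implicit Types (f : {mpoly rat[n]}) (i : 'I_n.-1).

Lemma leq_predn : (n.-1 <= N.-1)%N.
Proof. by move: le_nN; lia. Qed.

Definition widen_label i : 'I_N.-1 := widen_ord leq_predn i.

Lemma mpoly_widenX (a : 'I_n) :
  mpoly_widen le_nN 'X_a = 'X_(widen_ord le_nN a).
Proof. by rewrite /mpoly_widen comp_mpolyXU -tnth_nth tnth_mktuple. Qed.

Lemma mpoly_widen_msym i f :
  mpoly_widen le_nN (msym (simple i) f)
  = msym (simple (widen_label i)) (mpoly_widen le_nN f).
Proof.
rewrite /mpoly_widen msym_mPo; symmetry.
apply: (@lrmorph_comp_mpoly n N N (msym (simple (widen_label i)))) => a.
rewrite !tnth_mktuple; apply: etrans (msymXU _ _) _; congr 'X_(_); apply: val_inj.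
by rewrite /= !simple_val.
Qed.

Lemma mpoly_widen_divided_difference i f :
  mpoly_widen le_nN (divided_difference i f)
  = divided_difference (widen_label i) (mpoly_widen le_nN f).
Proof.
symmetry; apply: divided_difference_unique.
have x1 : x_this (widen_label i) = mpoly_widen le_nN (x_this i).
  by rewrite /x_this mpoly_widenX; congr 'X_(_); apply: val_inj.
have x2 : x_next (widen_label i) = mpoly_widen le_nN (x_next i).
  by rewrite /x_next mpoly_widenX; congr 'X_(_); apply: val_inj.
rewrite -mpoly_widen_msym x1 x2 /mpoly_widen -comp_mpolyB.
rewrite -[LHS](rmorphM (comp_mpoly _)) divided_differenceP.
exact: comp_mpolyB.
Qed.

Lemma mpoly_widen_word_dd (t : seq 'I_n.-1) f :
  mpoly_widen le_nN (word_dd t f)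
  = word_dd (map widen_label t) (mpoly_widen le_nN f).
Proof.
by elim: t => [|i t IH]; last exact: etrans (mpoly_widen_divided_difference _ _)
  (congr1 (divided_difference _) IH).
Qed.

Lemma mpoly_widen_pair_product (r : rel nat) :
  (forall a b, r a b -> (a < n)%N && (b < n)%N) ->
  mpoly_widen le_nN (pair_product n r) = pair_product N r.
Proof.
move=> rn; pose wd := widen_ord le_nN.
have wd_inj : injective wd.
  by move=> a b /(congr1 val) e; apply: val_inj.
have -> : pair_product N r = \prod_(A in pairs n r) var_sum (wd @: A).
  rewrite /pair_product /prod_var_sums; set S := pairs n r.
  have -> : pairs N r = (fun A : {set 'I_n} => wd @: A) @: S.
    apply/setP => A; apply/pairsP/imsetP => [[a [b [-> rab]]]|[B]].
      have /andP[an bn] := rn _ _ rab; exists [set Ordinal an; Ordinal bn].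
        by apply/pairsP; exists (Ordinal an), (Ordinal bn).
      by rewrite imsetU1 imset_set1; congr [set _; _]; apply: val_inj.
    case/pairsP => a [b [-> rab]] ->; exists (wd a), (wd b).
    by rewrite imsetU1 imset_set1.
  by rewrite big_imset //= => A B _ _; apply: imset_inj.
rewrite /pair_product /prod_var_sums /mpoly_widen rmorph_prod.
apply: eq_bigr => A _; rewrite /var_sum big_imset /=; last first.
  by move=> a b _ _; apply: wd_inj.
by rewrite linear_sum; apply: eq_bigr => a _; apply: mpoly_widenX.
Qed.

End Widening.

Lemma mpoly_widen_trans n N M (le_nN : (n <= N)%N) (le_NM : (N <= M)%N)
    (le_nM : (n <= M)%N) f :
  mpoly_widen le_NM (mpoly_widen le_nN f) = mpoly_widen le_nM f.
Proof.
apply: (@lrmorph_comp_mpoly n N M (mpoly_widen le_NM)) => a.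
rewrite !tnth_mktuple /=; apply: etrans (mpoly_widenX _ _) _.
by congr 'X_(_); apply: val_inj.
Qed.

Lemma mpoly_widen_id n (le_nn : (n <= n)%N) f : mpoly_widen le_nn f = f.
Proof.
by rewrite -[RHS]comp_mpoly_id; congr (_ \mPo _).
Qed.

Section ClimbExtension.
Variables (n N : nat) (le_nN : (n <= N)%N).

Definition extends (w : 'S_n) (w' : 'S_N) :=
  forall x, (x < n)%N -> permn w' x = permn w x.

(** A climb of w only involves positions below n, so it is also a climb of any
    extension of w, and stops at an extension of the longest element. *)
Lemma climb_extends (w : 'S_n) (w' : 'S_N) t : extends w w' -> climb w t ->
  exists u' : 'S_N, [/\ extends (longest n) u',
    forall x, (n <= x)%N -> permn u' x = permn w' x
  & forall c, climb u' c -> climb w' (map (widen_label le_nN) t ++ c)].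
Proof.
elim: t w w' => [|i t IH] w w' ext /=; first by move/eqP => wl; exists w'; rewrite -wl.
case/andP=> ai ct; have i1 := ltn_ord i; pose i' := widen_label le_nN i.
have fi : fixes_pair i' w' = fixes_pair i w.
  by rewrite /fixes_pair /= !ext //; lia.
have ai' : ascent i' w' by move: ai; rewrite /ascent /= !ext //; lia.
have swap_lt x : (swap_nat i x < n)%N = (x < n)%N.
  by rewrite /swap_nat; split_eqs; lia.
have ext' : extends (up i w) (up i' w').
  move=> x xn; rewrite !permn_up fi /= ext //.
  by case: ifP => // _; rewrite swap_lt.
have [u' [e1 e2 e3]] := IH _ _ ext' ct; exists u'; split=> //.
  move=> x nx; rewrite e2 // permn_up /= fi.
  have out y : (n <= y)%N -> swap_nat i y = y.
    by move=> ny; rewrite swap_natD //; lia.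
  rewrite (_ : (if _ then _ else _) = x); last by case: ifP; rewrite ?out.
  apply: out; rewrite leqNgt; apply/negP => lt.
  have zn : (permn w^-1%g (permn w' x) < n)%N by rewrite permn_lt.
  have := ext _ zn; rewrite -permnM mulVg permn1 => /permn_inj e.
  by rewrite e ltnNge nx in zn.
by move=> c /e3; rewrite ai'.
Qed.

End ClimbExtension.

Section OrthogonalStep.
Variable n : nat.

(** The involution on n + 1 points that fixes k and is order reversing on the
    positions n - k, ..., k - 1 and on the union of the outer positions.  It is
    the extended longest element for k = n; going up along the label k - 1
    moves the fixed point to k - 1, until it meets the centre. *)
Definition moved_fixed_point (k x : nat) : nat :=
  if (x < n - k)%N || (k < x)%N then (n - x)%N
  else if x == k then k else (n - x.+1)%N.

(** The staircase for n together with those cells of the next antidiagonal that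
    are not yet erased when the fixed point sits at k. *)
Definition middle_antidiagonal (k : nat) : rel nat := fun a b =>
  (a + b + 2 <= n)%N || (a + b + 1 == n)%N && ((k <= a)%N || (k <= b)%N).

Lemma climb_moved_fixed_point k : (k <= n)%N -> (n <= k + k + 1)%N ->
  exists c : seq 'I_n.+1.-1,
    (forall w : 'S_n.+1,
       (forall x, (x <= n)%N -> permn w x = moved_fixed_point k x) -> climb w c)
    /\ word_dd c (pair_product n.+1 (staircase true n.+1))
       = pair_product n.+1 (middle_antidiagonal k).
Proof.
elim: k => [|k IH] kn nk.
  exists [::]; split=> [w wE|].
    apply/eqP/eq_permn => x xn; rewrite wE // permn_longest //.
    by rewrite /moved_fixed_point; split_ifs; lia.
  by apply: eq_pair_product => a b _ _; rewrite /staircase /middle_antidiagonal; lia.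
(* Here the fixed point is central, or has just been absorbed by the dashed
   edge, and the involution is the longest element. *)
have [nk'|nk'] := leqP (k.+1 + k.+1) n.
  exists [::]; split=> [w wE|].
    apply/eqP/eq_permn => x xn; rewrite wE // permn_longest //.
    by rewrite /moved_fixed_point; split_ifs; lia.
  by apply: eq_pair_product => a b _ _; rewrite /staircase /middle_antidiagonal; lia.
have [||c [cw cP]] := IH; try lia.
pose i : 'I_n.+1.-1 := Ordinal kn.
exists (i :: c); split=> [w wE|].
  have wk : permn w k = (n - k.+1)%N.
    by rewrite wE /moved_fixed_point; [split_ifs; lia | lia].
  have wk1 : permn w k.+1 = k.+1.
    by rewrite wE /moved_fixed_point; [split_ifs; lia | lia].
  apply/andP; split; first by rewrite /ascent /= wk wk1; lia.
  apply: cw => x xn; rewrite permn_up /fixes_pair /= wk wk1.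
  have [->|xk] := eqVneq x k.
    case: ifP => fx; rewrite ?swapE ?wk ?wk1 ?swapE /moved_fixed_point /swap_nat;
      by split_ifs; lia.
  have [->|xk1] := eqVneq x k.+1.
    case: ifP => fx; rewrite ?swapE ?wk ?wk1 ?swapE /moved_fixed_point /swap_nat;
      by split_ifs; lia.
  rewrite (@swap_natD k x) // if_same wE // /moved_fixed_point.
  by split_ifs; rewrite /swap_nat; split_ifs; lia.
rewrite /word_dd /= -/(word_dd c _) cP.
apply: (@divided_difference_pair_product _ i (n - k.+1)); rewrite /middle_antidiagonal /=.
- lia.
- lia.
- lia.
- lia.
- by move=> a b an bn; rewrite /swap_nat; split_eqs; lia.
- by move=> a b an bn; lia.
Qed.

Lemma stable_step_O (w : 'S_n) (w' : 'S_n.+1) t : extends w w' ->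
  permn w' n = n -> climb w t ->
  exists u, climb w' u /\
    word_dd u (pair_product n.+1 (staircase true n.+1))
    = mpoly_widen (leqnSn n) (word_dd t (pair_product n (staircase true n))).
Proof.
move=> ext w'n ct.
have [u' [e1 e2 e3]] := climb_extends (leqnSn n) ext ct.
have [|c [cw cP]] := climb_moved_fixed_point (leqnn n); first by lia.
exists (map (widen_label (leqnSn n)) t ++ c); split.
  apply/e3/cw => x; rewrite leq_eqVlt => /orP[/eqP ->|xn].
    by rewrite e2 // w'n /moved_fixed_point; split_ifs; lia.
  rewrite e1 // permn_longest // /moved_fixed_point; split_ifs; lia.
rewrite mpoly_widen_word_dd /word_dd foldr_cat -/(word_dd c _) cP.
congr foldr; rewrite mpoly_widen_pair_product.
  by apply: eq_pair_product => a b an bn; rewrite /staircase /middle_antidiagonal; lia.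
by move=> a b; rewrite /staircase; lia.
Qed.

End OrthogonalStep.

Section SymplecticStep.
Variable m : nat.
Let M := m.*2.

(** The involution on M + 2 points that exchanges the adjacent points M - k and
    M - k + 1 and is order reversing on the k outer positions on either side
    and on the positions in between.  It is the embedded longest element for
    k = 0; two steps up replace k by k + 1, and k = m gives the longest
    element. *)
Definition moved_exchange (k x : nat) : nat :=
  if (x < k)%N || (M + 2 - k <= x)%N then (M + 1 - x)%N
  else if x == (M - k)%N then (M - k).+1
  else if x == (M - k).+1 then (M - k)%N else (M - x.+1)%N.

(** The staircase for M together with those cells of the next two antidiagonals
    that are not yet erased. *)
Definition outer_antidiagonals (k : nat) : rel nat := fun a b =>
  (a != b) && ((a + b + 2 <= M)%N ||
   (M <= a + b + 1 <= M + 1)%N && ((a < k)%N || (b < k)%N)).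

Lemma climb_moved_exchange e k : (e + k)%N = m ->
  exists c : seq 'I_m.+1.*2.-1,
    (forall w : 'S_(m.+1.*2),
       (forall x, (x < M + 2)%N -> permn w x = moved_exchange k x) -> climb w c)
    /\ word_dd c (pair_product m.+1.*2 (staircase false m.+1.*2))
       = pair_product m.+1.*2 (outer_antidiagonals k).
Proof.
have ME : m.+1.*2 = (M + 2)%N by rewrite /M; lia.
have M2 : M = (m + m)%N by rewrite /M addnn.
elim: e k => [|e IH] k ek.
  exists [::]; split=> [w wE|].
    apply/eqP/eq_permn => x xn; rewrite wE -?ME // permn_longest //.
    by rewrite /moved_exchange; split_ifs; lia.
  by apply: eq_pair_product => a b _ _; rewrite /staircase /outer_antidiagonals; lia.
have [|c [cw cP]] := IH k.+1; first by lia.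
have [p pM] : exists p, (p + k.+1)%N = M by exists (M - k.+1)%N; lia.
have i1 : (p < m.+1.*2.-1)%N by lia.
have i2 : (p.+1 < m.+1.*2.-1)%N by lia.
pose i := Ordinal i1; pose j := Ordinal i2.
exists (i :: j :: c); split=> [w wE|].
  have w0 : permn w p = k.
    by rewrite wE; [rewrite /moved_exchange; split_ifs; lia|lia].
  have w1 : permn w p.+1 = p.+2.
    by rewrite wE; [rewrite /moved_exchange; split_ifs; lia|lia].
  have w2 : permn w p.+2 = p.+1.
    by rewrite wE; [rewrite /moved_exchange; split_ifs; lia|lia].
  have kp : (k < p)%N by lia.
  have fi : fixes_pair i w = false by rewrite /fixes_pair /= w0 w1; lia.
  have fj : fixes_pair j (up i w) = false.
    by rewrite /fixes_pair !permn_up fi /= ?swapE w0 /swap_nat; split_eqs; lia.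
  have uE x : permn (up j (up i w)) x =
      swap_nat p.+1 (swap_nat p (permn w (swap_nat p (swap_nat p.+1 x)))).
    by rewrite permn_up fj permn_up fi.
  apply/and3P; split.
  - by rewrite /ascent /= w0 w1; lia.
  - by rewrite /ascent !permn_up fi /= ?swapE w0 w2 ?swapE swap_natD; lia.
  apply: cw => x xn; rewrite uE.
  have [->|xp] := eqVneq x p.
    rewrite ?swapE w1 ?swapE.
    by rewrite /moved_exchange; split_ifs; lia.
  have [->|xp1] := eqVneq x p.+1.
    rewrite ?swapE w2 ?swapE.
    by rewrite /moved_exchange; split_ifs; lia.
  have [->|xp2] := eqVneq x p.+2.
    rewrite ?swapE w0 !swap_natD; try lia.
    by rewrite /moved_exchange; split_ifs; lia.
  rewrite (@swap_natD p.+1 x) // (@swap_natD p x) // wE //.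
  rewrite /moved_exchange; split_ifs; try (exfalso; lia);
    by rewrite /swap_nat; split_eqs; lia.
rewrite /word_dd /= -/(word_dd c _) cP.
(* The first of the two steps erases the pair {M - k, k}, the second one the
   pair {M - k - 1, k}, which r still contains. *)
pose r : rel nat := fun a b =>
  outer_antidiagonals k a b || (a + b == M - 1)%N && ((a == k) || (b == k)).
have -> : divided_difference j (pair_product m.+1.*2 (outer_antidiagonals k.+1))
    = pair_product m.+1.*2 r.
  apply: (@divided_difference_pair_product _ j k);
    rewrite /r /outer_antidiagonals /=; try lia.
    by move=> a b _ _; rewrite /swap_nat; split_eqs; lia.
apply: (@divided_difference_pair_product _ i k);
  rewrite /r /outer_antidiagonals /=; try lia.
by move=> a b _ _; rewrite /swap_nat; split_eqs; lia.
Qed.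

Lemma stable_step_Sp (w : 'S_(m.*2)) (w' : 'S_(m.+1.*2)) t
    (le_m : (m.*2 <= m.+1.*2)%N) : extends w w' ->
  permn w' M = M.+1 -> permn w' M.+1 = M -> climb w t ->
  exists u, climb w' u /\
    word_dd u (pair_product m.+1.*2 (staircase false m.+1.*2))
    = mpoly_widen le_m (word_dd t (pair_product m.*2 (staircase false m.*2))).
Proof.
move=> ext w'1 w'2 ct.
have [u' [e1 e2 e3]] := climb_extends le_m ext ct.
have [c [cw cP]] := climb_moved_exchange (addn0 m).
exists (map (widen_label le_m) t ++ c); split.
  apply/e3/cw => x xM; have [xn|xn] := ltnP x M.
    by rewrite e1 // permn_longest // /moved_exchange; split_ifs; lia.
  have [->|->] : x = M \/ x = M.+1 by lia.
    by rewrite e2 // w'1 /moved_exchange; split_ifs; lia.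
  by rewrite e2 ?w'2 /moved_exchange; split_ifs; lia.
rewrite mpoly_widen_word_dd /word_dd foldr_cat -/(word_dd c _) cP.
congr foldr; rewrite mpoly_widen_pair_product.
  apply: eq_pair_product => a b an bn; rewrite /staircase /outer_antidiagonals.
  by rewrite /M; lia.
by move=> a b; rewrite /staircase; lia.
Qed.

End SymplecticStep.

(** * Powers of two *)

Section Excedances.
Variable n : nat.
Implicit Types (i : 'I_n.-1) (w : 'S_n).

(** For an involution, these index its 2-cycles. *)
Definition excedances w : {set 'I_n} := [set a : 'I_n | (a < w a)%N].

Lemma excedances_up i w : ascent i w -> w \in invol n ->
  #|excedances (up i w)| = (#|excedances w| + fixes_pair i w)%N.
Proof.
move=> ai wI; rewrite /up; case: ifP => [/andP[/eqP e1 /eqP e2]|nf].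
  have -> : excedances (w * simple i)%g = ord_this i |: excedances w.
    apply/setP => a; rewrite !inE -!permn_ord permnM permn_simple -val_eqE /=.
    have [->|ai0] := eqVneq (a : nat) i; first by rewrite e1 swapE leqnn.
    have [->|ai1] := eqVneq (a : nat) i.+1; first by rewrite e2 swapE; lia.
    rewrite swap_natD //; first by rewrite -[X in _ != X]e1 (inj_eq (@permn_inj _ w)).
    by rewrite -[X in _ != X]e2 (inj_eq (@permn_inj _ w)).
  rewrite cardsU1 !inE -permn_ord /= e1 ltnn /=; lia.
have -> : excedances (conj_simple i w) = (simple i : 'I_n -> 'I_n) @^-1: excedances w.
  apply/setP => a; rewrite !inE -!permn_ord permn_conj permn_simple.
  set b := swap_nat i a.
  have s1 : permn w b = i -> permn w i = b by exact: permn_sym.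
  have s2 : permn w b = i.+1 -> permn w i.+1 = b by exact: permn_sym.
  have b1 : b = i -> permn w b = permn w i by move=> ->.
  have b2 : b = i.+1 -> permn w b = permn w i.+1 by move=> ->.
  have -> : (a : nat) = swap_nat i b by rewrite swap_natK.
  clearbody b; move: ai s1 s2 b1 b2; rewrite /ascent /swap_nat.
  by split_eqs; lia.
rewrite addn0 card_preimset //; exact: perm_inj.
Qed.

(** Every factor 1/2 of a dashed edge is absorbed by the loss of one 2-cycle, so
    that the scalar depends on the endpoint only. *)
Lemma Upsilon_O_word t (f : {mpoly rat[n]}) :
  Upsilon_longest_O n = 2 ^+ #|excedances (longest n)| *: f ->
  all_steps_change (@act_O n) t ->
  Upsilon_O t = 2 ^+ #|excedances (path_end (@act_O n) t)| *: word_dd t f.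
Proof.
move=> top; elim: t => [|i t IH] /=; first by move=> _; exact: top.
case/andP=> ne ct; have [pI _] := path_O_invol_climb ct.
have [wI ai e ->] := act_O_up pI ne.
move: (IH ct) (excedances_up ai wI); rewrite e => -> ->.
case: fixes_pair; rewrite divided_differenceZ; last by rewrite addn0; reflexivity.
by rewrite scalerA addn1 exprS mulrA mulVf // mul1r; reflexivity.
Qed.

End Excedances.

(** Each diagonal factor x_a + x_a is twice the sum over the singleton of a. *)
Lemma prod_sum_pairs n (r : rel nat) : (forall a b, r a b = r b a) ->
  \prod_(a < n) \prod_(b < n | (a <= b)%N && r a b) ('X_a + 'X_b)
  = 2 ^+ #|[set a : 'I_n | r a a]| *: pair_product n r :> {mpoly rat[n]}.
Proof.
move=> r_sym; rewrite pair_big_dep /=.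
pose D : {set 'I_n * 'I_n} := [set p : 'I_n * 'I_n | (p.1 <= p.2)%N && r p.1 p.2].
pose f (p : 'I_n * 'I_n) := [set p.1; p.2].
have f_inj : {in D &, injective f}.
  move=> [a b] [c d]; rewrite !inE /= => /andP[ab _] /andP[cd _] /set2_eq.
  case=> -[/= ea eb]; first by rewrite ea eb.
  by move: ab cd; rewrite ea eb => *; congr (_, _); apply: val_inj => /=; lia.
have fD : pairs n r = f @: D.
  apply/setP => A; apply/pairsP/imsetP => [[a [b [-> rab]]]|[[a b]]].
    have [ab|ba] := leqP a b; first by exists (a, b); rewrite ?inE /= ?ab.
    by exists (b, a); rewrite ?inE /= ?(ltnW ba) 1?r_sym // /f setUC.
  by rewrite inE => /andP[_ rab] ->; exists a, b.
rewrite /pair_product /prod_var_sums fD big_imset //=.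
transitivity (\prod_(p in D) ((if p.1 == p.2 then 2 else 1) *: var_sum (f p))).
  apply: eq_big => [[a b]|[a b] _]; first by rewrite inE.
  rewrite /var_sum /f /=; case: eqVneq => [->|ab].
    by rewrite setUid big_set1 scaler_nat.
  by rewrite big_setU1 ?inE // big_set1 scale1r.
rewrite scaler_prod; congr (_ *: _).
rewrite -big_mkcondr prodr_const; congr (_ ^+ _).
pose g (a : 'I_n) := (a, a); have g_inj : injective g by move=> a b [].
rewrite -[RHS](card_imset _ g_inj); apply: eq_card => -[a b].
rewrite unfold_in /= [_ \in D]inE /=.
apply/idP/imsetP => [/andP[/andP[_ rab] /eqP e]|[c]].
  by exists a; rewrite ?inE e // -{1}e.
by rewrite inE => rcc [-> ->]; rewrite leqnn rcc eqxx.
Qed.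

Lemma Upsilon_longest_O_pairs n :
  Upsilon_longest_O n = 2 ^+ #|excedances (longest n)|
    *: pair_product n (staircase true n).
Proof.
have -> : excedances (longest n) = [set a : 'I_n | staircase true n a a].
  apply/setP => a; rewrite !inE permE /= /staircase; have := ltn_ord a; lia.
rewrite -prod_sum_pairs; last by move=> a b; rewrite /staircase; lia.
apply: eq_bigr => a _; apply: eq_bigl => b; rewrite /staircase; lia.
Qed.

Lemma Upsilon_longest_Sp_pairs n :
  Upsilon_longest_Sp n = pair_product n (staircase false n).
Proof.
have diag0 : #|[set a : 'I_n | staircase false n a a]| = 0%N.
  by apply/eq_card0 => a; rewrite !inE /staircase eqxx.
rewrite -[RHS]scale1r -(expr0 2) -[X in _ ^+ X]diag0 -prod_sum_pairs; last first.
  by move=> a b; rewrite /staircase; lia.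
apply: eq_bigr => a _; apply: eq_bigl => b; rewrite /staircase; lia.
Qed.

Lemma Upsilon_Sp_word n (t : seq 'I_n.-1) :
  Upsilon_Sp t = word_dd t (pair_product n (staircase false n)).
Proof.
elim: t => [|i t IH]; first exact: Upsilon_longest_Sp_pairs.
exact (congr1 (divided_difference i) IH).
Qed.

(** * Stability under the embeddings *)

Section Embedding.
Variables (n N : nat) (le_nN : (n <= N)%N).
Implicit Type w : 'S_n.

Lemma extend_fun_lt (rest : 'I_N -> 'I_N) w (k : 'I_N) : (k < n)%N ->
  extend_fun le_nN rest w k = permn w k :> nat.
Proof.
by move=> kn; rewrite (@extend_fun_in _ _ _ _ _ k (Ordinal kn)) //= -permn_ord.
Qed.

Lemma permn_iota w x : permn (perm_iota le_nN w) x = permn w x.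
Proof.
have [xn|nx] := ltnP x n.
  have xN := leq_trans xn le_nN.
  by rewrite (permn_ord _ (Ordinal xN)) permE extend_fun_lt.
rewrite (permn_out _ nx); have [xN|Nx] := ltnP x N; last by rewrite permn_out.
by rewrite (permn_ord _ (Ordinal xN)) permE extend_fun_out.
Qed.

Lemma excedances_iota w : #|excedances (perm_iota le_nN w)| = #|excedances w|.
Proof.
pose wd := widen_ord le_nN.
have wd_inj : injective wd.
  by move=> a b /(congr1 val) e; apply: val_inj.
rewrite -(card_imset _ wd_inj); apply: eq_card => a.
rewrite inE -permn_ord permn_iota; apply/idP/imsetP => [aw|[b]].
  have an : (a < n)%N.
    by rewrite ltnNge; apply/negP => na; rewrite permn_out // ltnn in aw.
  by exists (Ordinal an); [rewrite inE -permn_ord | apply: val_inj].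
by rewrite inE -permn_ord => bw ->.
Qed.

End Embedding.

Lemma stable_O n N (le_nN : (n <= N)%N) (w : 'S_n) t :
  w \in invol n -> climb w t ->
  exists u, climb (perm_iota le_nN w) u /\
    word_dd u (pair_product N (staircase true N))
    = mpoly_widen le_nN (word_dd t (pair_product n (staircase true n))).
Proof.
move=> wI ct; elim: N le_nN => [|N IH] le_nN.
  have n0 : n = 0%N by lia.
  subst n; exists t; rewrite mpoly_widen_id; split; last by [].
  by rewrite (_ : perm_iota _ _ = w) //; apply: eq_permn.
have [e|ne] := eqVneq n N.+1.
  subst n; exists t; rewrite mpoly_widen_id; split; last by [].
  by rewrite (_ : perm_iota _ _ = w) //; apply: eq_permn => x _; rewrite permn_iota.
have le' : (n <= N)%N by lia.
have [u [cu uP]] := IH le'.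
have ext : extends (perm_iota le' w) (perm_iota le_nN w).
  by move=> x _; rewrite !permn_iota.
have [|v [cv vP]] := stable_step_O ext _ cu.
  by rewrite permn_iota permn_out.
exists v; split=> //; rewrite vP uP; exact: mpoly_widen_trans.
Qed.

Lemma permn_iota_fpf n N (le_nN : (n <= N)%N) (w : 'S_(n.*2)) x :
  (x < N.*2)%N ->
  permn (perm_iota_fpf le_nN w) x = if (x < n.*2)%N then permn w x else mate x.
Proof.
move=> xN; rewrite (permn_ord _ (Ordinal xN)) permE.
by case: ltnP => xn; [rewrite extend_fun_lt | rewrite extend_fun_out].
Qed.

Lemma stable_Sp n N (le_nN : (n <= N)%N) (w : 'S_(n.*2)) t :
  w \in invol n.*2 -> climb w t ->
  exists u, climb (perm_iota_fpf le_nN w) u /\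
    word_dd u (pair_product N.*2 (staircase false N.*2))
    = mpoly_widen (double_le le_nN)
        (word_dd t (pair_product n.*2 (staircase false n.*2))).
Proof.
move=> wI ct; elim: N le_nN => [|N IH] le_nN.
  have n0 : n = 0%N by lia.
  subst n; exists t; rewrite mpoly_widen_id; split; last by [].
  by rewrite (_ : perm_iota_fpf _ _ = w) //; apply: eq_permn.
have [e|ne] := eqVneq n N.+1.
  subst n; exists t; rewrite mpoly_widen_id; split; last by [].
  rewrite (_ : perm_iota_fpf _ _ = w) //; apply: eq_permn => x xn.
  by rewrite permn_iota_fpf // xn.
have le' : (n <= N)%N by lia.
have [u [cu uP]] := IH le'.
have ext : extends (perm_iota_fpf le' w) (perm_iota_fpf le_nN w).
  by move=> x xN; rewrite !permn_iota_fpf //; lia.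
have lt1 : (N.*2 < n.*2)%N = false by lia.
have lt2 : (N.*2.+1 < n.*2)%N = false by lia.
have [||v [cv vP]] := stable_step_Sp (double_le (leqnSn N)) ext _ _ cu.
- by rewrite permn_iota_fpf ?lt1 /mate ?odd_double //; lia.
- by rewrite permn_iota_fpf ?lt2 /mate /= ?odd_double //; lia.
exists v; split=> //; rewrite vP uP; exact: mpoly_widen_trans.
Qed.

Theorem theorem1p4 (n N : nat) (n_gt0 : (0 < n)%N) (le_nN : (n <= N)%N) :
  (forall w : 'S_n, w \in invol n ->
     forall (t : seq 'I_n.-1) (u : seq 'I_N.-1),
       labelled_path (@act_O n) w t ->
       labelled_path (@act_O N) (perm_iota le_nN w) u ->
       Upsilon_O u = mpoly_widen le_nN (Upsilon_O t))
  /\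
  (forall w : 'S_(n.*2), w \in invol_fpf n.*2 ->
     forall (t : seq 'I_(n.*2).-1) (u : seq 'I_(N.*2).-1),
       labelled_path (@act_Sp n.*2) w t ->
       labelled_path (@act_Sp N.*2) (perm_iota_fpf le_nN w) u ->
       Upsilon_Sp u = mpoly_widen (double_le le_nN) (Upsilon_Sp t)).
Proof.
split=> w wI t u pt pu.
  have ct := labelled_path_O_climb pt; have cu := labelled_path_O_climb pu.
  have [v [cv vP]] := stable_O le_nN wI ct.
  have uP := @staircase_path_independent true N _ isT (perm_iota_invol le_nN wI) _ _ cu cv.
  have /andP[st /eqP et] := pt; have /andP[su /eqP eu] := pu.
  rewrite (Upsilon_O_word (Upsilon_longest_O_pairs n) st) et.
  rewrite (Upsilon_O_word (Upsilon_longest_O_pairs N) su) eu.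
  rewrite excedances_iota /mpoly_widen comp_mpolyZ.
  exact: congr1 (etrans uP vP).
have ct := labelled_path_Sp_climb pt; have cu := labelled_path_Sp_climb pu.
have wI' : w \in invol n.*2 by move: wI; rewrite inE => /andP[].
have ioI : perm_iota_fpf le_nN w \in invol N.*2.
  by have := perm_iota_fpf_invol le_nN wI; rewrite inE => /andP[].
have [v [cv vP]] := stable_Sp le_nN wI' ct.
have evenN : false || ~~ odd N.*2 by rewrite odd_double.
have uP := @staircase_path_independent false N.*2 _ evenN ioI _ _ cu cv.
rewrite (Upsilon_Sp_word t); apply: etrans (Upsilon_Sp_word u) _.
exact (etrans uP vP).
Qed.
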